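(* Let $d\geq 2$, $R>0$, $\delta>0$. There exists a constant $C>0$ depending only on $\delta$ and $R$ such that the following holds. Let $X^{+},X^{-}\subset R\mathbb{B}_2^d$ be two $\delta$-separated sets and define \[ k:=C\left(\frac{32R}{\delta^2}\right)^2\left(w^2\big((X^+-X^-)\cup X^+\cup X^-\big)+R^2\right). \] If $X^+,X^-$ are finite, let $N:=|X^+|+|X^-|$ and $\gamma:=\delta^2/(18R\sqrt k)$; otherwise assume $X^+,X^-$ have $(\delta,144\delta^{-2}R^3\sqrt k)$-mutual complexity $N$ and let $\gamma:=\delta^2/(36R\sqrt k)$. Consider the random one-layer network $\Phi(x)=\mathrm{ReLU}(Wx+b)$ with $W\in\mathbb{R}^{n\times d}$ having i.i.d. $\mathcal N(0,1)$ entries and independent bias $b\sim\mathrm{Unif}([-\lambda,\lambda]^n)$, where $\lambda\geq 9R\sqrt k/8$. Let $\eta\in(0,1)$ and suppose \[ n\geq\frac{\log(N/\eta)}{q},\qquad q:=\frac{R}{4\lambda\sqrt k}\left(\frac{2\delta^2}{81R^2}\right)^k. \] Then, with probability at least $1-\eta$, the sets $\Phi(X^+),\Phi(X^-)\subset\mathbb{R}^n$ are linearly separable with margin at least \[ \mathcal{M}(\gamma,N):=\sqrt{\frac{4R(R+\gamma)}{N(1+2R/\gamma)^{2N}-N}}. \]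
   Context: $\|\cdot\|$ is the Euclidean norm, $\mathbb{B}_2^d(c,r)$ the closed Euclidean ball of radius $r$ centered at $c$, $R\mathbb{B}_2^d:=\mathbb{B}_2^d(0,R)$, $\mathrm{dist}(x,S):=\inf\{\|x-y\|:y\in S\}$, $X^+-X^-:=\{x^+-x^-:x^\pm\in X^\pm\}$. $\mathrm{ReLU}(x)=\max(x,0)$ coordinatewise. The Gaussian width of $T\subset\mathbb{R}^d$ is $w(T):=\mathbb{E}\sup_{x\in T}g^Tx$ with $g\sim\mathcal N(0,I_d)$. Two sets are $\delta$-separated if $\|x^+-x^-\|\geq\delta$ for all $x^+\in X^+,x^-\in X^-$. $S^+,S^-\subset\mathbb{R}^n$ are linearly separable if there are nonzero $a\in\mathbb{R}^n$ and $c\in\mathbb{R}$ with $a^Ts+c>0$ on $S^+$ and $<0$ on $S^-$; its margin is $\inf\{|a^Ts+c|/\|a\|:s\in S^+\cup S^-\}$. Mutual complexity: $\delta$-separated $X^+,X^-\subset R\mathbb{B}_2^d$ have $(\delta,\mu)$-mutual complexity $N$ if there exist finite sets $C^+=\{c_i^+\}_{i=1}^{N^+}$, $C^-=\{c_j^-\}_{j=1}^{N^-}\subset\mathbb{R}^d$ with $N^++N^-=N$ and radii $r_i^+,r_j^-\geq0$ such that: (1) $X^+\subset\bigcup_iX_i^+$, $X^-\subset\bigcup_jX_j^-$ where $X_i^+:=X^+\cap\mathbb{B}_2^d(c_i^+,r_i^+)$, $X_j^-:=X^-\cap\mathbb{B}_2^d(c_j^-,r_j^-)$, with $c_i^+\in\mathrm{conv}(X_i^+)$,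 $c_j^-\in\mathrm{conv}(X_j^-)$; (2) $r_i^+\leq\mu^{-1}\mathrm{dist}(c_i^+,C^-)^2$, $r_j^-\leq\mu^{-1}\mathrm{dist}(c_j^-,C^+)^2$; (3) $C^+$ and $C^-$ are $\delta$-separated. *)

(* Defs.v *)
From HB Require Import structures.
From mathcomp Require Import all_boot all_order all_algebra.
From mathcomp Require Import all_classical all_reals all_analysis.
Set Implicit Arguments.
Unset Strict Implicit.
Unset Printing Implicit Defensive.
Import Order.TTheory GRing.Theory Num.Theory.
Import numFieldNormedType.Exports.
Local Open Scope classical_set_scope.
Local Open Scope ring_scope.

Section Defs.
Variable R : realType.

Definition dotv (d : nat) (u v : 'cV[R]_d) : R := \sum_(i < d) u i 0 * v i 0.
Definition norm2 (d : nat) (v : 'cV[R]_d) : R := Num.sqrt (\sum_(i < d) v i 0 ^+ 2).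

Definition ball2 (d : nat) (c : 'cV[R]_d) (r : R) : set 'cV[R]_d :=
  [set x | norm2 (x - c) <= r].

(** dist(x, S) = inf { ||x - y|| : y in S }, valued in \bar R (+oo if S = set0). *)
Definition edist (d : nat) (x : 'cV[R]_d) (S : set 'cV[R]_d) : \bar R :=
  ereal_inf [set (norm2 (x - y))%:E | y in S].

Definition mdiff (d : nat) (A B : set 'cV[R]_d) : set 'cV[R]_d :=
  [set z | exists x y, A x /\ B y /\ z = x - y].

Definition delta_separated (d : nat) (delta : R) (A B : set 'cV[R]_d) : Prop :=
  forall x y, A x -> B y -> delta <= norm2 (x - y).

Definition conv_hull (d : nat) (S : set 'cV[R]_d) : set 'cV[R]_d :=
  [set x | exists (m : nat) (w : 'I_m -> R) (p : 'I_m -> 'cV[R]_d),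
      [/\ forall i, 0 <= w i, \sum_(i < m) w i = 1, forall i, S (p i)
        & x = \sum_(i < m) w i *: p i]].

(** Expectation w.r.t. the standard Gaussian vector g ~ N(0, I_d) of a
    function of (g_0, ..., g_{d-1}), as an iterated Lebesgue integral
    against the standard normal density (coordinates g i, i < d). *)
Fixpoint gauss_exp (d : nat) (f : (nat -> R) -> \bar R) : \bar R :=
  match d with
  | 0 => f (fun _ => 0)
  | d'.+1 =>
      (\int[lebesgue_measure]_(t in [set: R])
         ((normal_pdf 0 1 t)%:E *
          gauss_exp d' (fun g => f (fun i => if i is i'.+1 then g i' else t)))%E)
  end.

(** Gaussian width w(T) = E sup_{x in T} g^T x (real-valued via fine; finite
    for bounded nonempty T). *)
Definition gaussian_width (d : nat) (T : set 'cV[R]_d) : R :=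
  fine (gauss_exp d (fun g =>
          ereal_sup [set (\sum_(i < d) g i * x i 0)%:E | x in T])).

Definition mutual_complexity (d : nat) (delta mu : R) (Xp Xm : set 'cV[R]_d)
    (N : nat) : Prop :=
  exists (Np Nm : nat) (cp : 'I_Np -> 'cV[R]_d) (cm : 'I_Nm -> 'cV[R]_d)
         (rp : 'I_Np -> R) (rm : 'I_Nm -> R),
    ((Np + Nm)%N = N) /\
        ((forall i, 0 <= rp i) /\ (forall j, 0 <= rm j)) /\
        ((Xp `<=` \bigcup_i (Xp `&` ball2 (cp i) (rp i))) /\
         (Xm `<=` \bigcup_j (Xm `&` ball2 (cm j) (rm j)))) /\
        ((forall i, conv_hull (Xp `&` ball2 (cp i) (rp i)) (cp i)) /\
         (forall j, conv_hull (Xm `&` ball2 (cm j) (rm j)) (cm j))) /\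
        ((forall i, ((rp i)%:E <= (mu^-1)%:E *
                      (edist (cp i) (range cm) * edist (cp i) (range cm)))%E) /\
        (forall j, ((rm j)%:E <= (mu^-1)%:E *
                      (edist (cm j) (range cp) * edist (cm j) (range cp)))%E)) /\
        (* (3) *) delta_separated delta (range cp) (range cm).

Definition lin_margin (n : nat) (a : 'cV[R]_n) (c : R) (S : set 'cV[R]_n) : \bar R :=
  ereal_inf [set (`|dotv a s + c| / norm2 a)%:E | s in S].

Definition lin_sep_margin (n : nat) (Sp Sm : set 'cV[R]_n) (M : R) : Prop :=
  exists (a : 'cV[R]_n) (c : R),
    [/\ a != 0, (forall s, Sp s -> 0 < dotv a s + c),
        (forall s, Sm s -> dotv a s + c < 0)
      & (M%:E <= lin_margin a c (Sp `|` Sm))%E].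

Definition relu (n : nat) (v : 'cV[R]_n) : 'cV[R]_n := map_mx (fun t => Num.max t 0) v.

Definition Mfun (R0 gamma : R) (N : nat) : R :=
  Num.sqrt (4 * R0 * (R0 + gamma) /
            (N%:R * (1 + 2 * R0 / gamma) ^+ (2 * N) - N%:R)).

Definition mutually_independent (dO : measure_display) (O : measurableType dO)
    (P : probability O R) (I : finType) (X : I -> {RV P >-> R}) : Prop :=
  forall B : I -> set R, (forall i, measurable (B i)) ->
    fine (P (\bigcap_i (X i @^-1` B i))) = \prod_(i : I) fine (P (X i @^-1` B i)).

End Defs.

(* Main.v *)
(* A neuron [relu (W_i x + b_i)] serves a cluster of centre [c] when it is active on
   that cluster, vanishes on all clusters of the opposite class whose centres are not
   longer than [c], and is bounded elsewhere.  If every cluster is served by some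
   neuron, ordering the clusters by the length of their centres and giving the
   serving neurons geometrically growing weights separates the two classes.

   For points [y] no longer than [x] and at distance at least [delta] from [x],
   [x.x - x.y >= delta^2 / 2]; hence a weight vector [g + s c] serves the cluster of
   [c] for all biases in a fixed interval as soon as the noise [g] satisfies
   [|g.x| <= L] on the data and [s = 36 L / delta^2].  With [L] comparable to the
   Gaussian width plus [R], Markov's inequality gives this bound on [g] probability
   at least 1/2, and the Cameron-Martin density shows that the shift by [s c] costs a
   factor at least [exp (- k)].  So each neuron serves a given cluster with
   probability at least [q], and independence of the [n] neurons concludes. *)
Require Import Defs.
From HB Require Import structures.
From mathcomp Require Import all_boot all_order all_algebra.
From mathcomp Require Import finmap all_classical all_reals all_analysis.
From mathcomp Require Import measurable_realfun ring lra.
Set Implicit Arguments.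
Unset Strict Implicit.
Unset Printing Implicit Defensive.
Import Order.TTheory GRing.Theory Num.Theory.
Import numFieldNormedType.Exports.
Local Open Scope classical_set_scope.
Local Open Scope ring_scope.

(** * Iterated Gaussian expectation on sequences *)

(** Two obstacles shape the development. The width is an iterated integral over functions of a
    sequence with zero tail, while the network lives on an abstract probability space and is known
    only through the laws and the independence of its scalar entries. Both are transported to one
    measurable space, sequences with the coordinate sigma-algebra, on which a measure is determined
    by its values on boxes. Moreover the separation event quantifies over possibly uncountable
    classes and need not be measurable; the measurable event exhibited inside it is that every
    cluster is served by some neuron. The base [2 delta^2 / (81 R^2)] in [q] is at most [8/81],
    hence below [1/e], because [delta <= 2 R] when both classes are nonempty; so the power in [q] is
    dominated by [exp (- k)]. Both cases of the theorem are instances of one statement on clusters,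
    a point of a finite class being a cluster of radius 0. *)

Section rseq.
Variable R : realType.

(** Generators of the product sigma-algebra. Infinite sequences serve all dimensions at once:
    [gauss_exp] evaluates on functions [nat -> R] and peels off coordinate 0, which [scons] puts
    back. *)
Definition coord_sets : set (set (nat -> R)) :=
  [set A | exists i B, measurable B /\ A = [set g | B (g i)]].

Definition rseq := g_sigma_algebraType coord_sets.
HB.instance Definition _ := Measurable.on rseq.

Definition scons (t : R) (g : nat -> R) : nat -> R :=
  fun i => if i is i'.+1 then g i' else t.

Lemma measurable_coord i : measurable_fun setT (fun g : rseq => g i).
Proof.
move=> _ B mB; rewrite setTI; apply: sub_sigma_algebra.
by exists i, B.
Qed.

Lemma measurable_to_rseq (d : measure_display) (T : measurableType d)
    (f : T -> rseq) :
  (forall i, measurable_fun setT (fun x => f x i)) -> measurable_fun setT f.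
Proof.
move=> mf; apply: (@measurability _ _ T rseq setT f coord_sets) => //.
move=> _ [_ [i [B [mB ->]]] <-].
exact: (mf i measurableT B mB).
Qed.

Lemma measurable_scons (d : measure_display) (T : measurableType d)
    (f : T -> R) (g : T -> rseq) :
  measurable_fun setT f -> measurable_fun setT g ->
  measurable_fun setT (fun x => scons (f x) (g x) : rseq).
Proof.
move=> mf mg; apply: measurable_to_rseq => -[|i] //=.
exact: (measurableT_comp (measurable_coord i) mg).
Qed.

Notation mu := (@lebesgue_measure R).
Notation phi := (@normal_pdf R 0 1).
Local Open Scope ereal_scope.

Lemma gauss_exp_ge0 d f : (forall g, 0 <= f g) -> 0 <= gauss_exp d f :> \bar R.
Proof.
elim: d f => [|d IH] f f0 //=.
apply: integral_ge0 => t _; apply: mule_ge0; first by rewrite lee_fin normal_pdf_ge0.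
exact: IH.
Qed.

Let mphi : measurable_fun [set: R] (EFin \o phi).
Proof. by apply/measurable_EFinP; exact: measurable_normal_pdf. Qed.

(** The parameter space is arbitrary because the induction enlarges it: the outer integration
    variable becomes a parameter of the inner expectation, and Tonelli handles the outer
    integral. *)
Lemma measurable_gauss_exp n (d : measure_display) (T : measurableType d)
    (F : T * rseq -> \bar R) : measurable_fun setT F -> (forall z, 0 <= F z) ->
  measurable_fun setT (fun y => gauss_exp n (fun g => F (y, g))).
Proof.
elim: n d T F => [|n IH] d T F mF F0 /=.
  exact: (@measurable_fun_pair1 _ _ _ _ _ _ F (fun=> 0%R)).
pose G (z : T * R) := (phi z.2)%:E * gauss_exp n (fun g => F (z.1, scons z.2 g)).
apply: (@measurable_fun_fubini_tonelli_F _ _ _ _ _ mu G).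
- apply: emeasurable_funM.
    exact: (measurableT_comp mphi measurable_snd).
  apply: (IH _ _ (fun z => F (z.1.1, scons z.1.2 z.2))) => //.
  apply: (measurableT_comp mF); apply: measurable_fun_pair.
    exact: (measurableT_comp measurable_fst measurable_fst).
  apply: measurable_scons => //.
  exact: (measurableT_comp measurable_snd measurable_fst).
- move=> z; apply: mule_ge0; first by rewrite lee_fin normal_pdf_ge0.
  exact: gauss_exp_ge0.
Qed.

Lemma measurable_gauss_exp_scons n (f : rseq -> \bar R) :
  measurable_fun setT f -> (forall z, 0 <= f z) ->
  measurable_fun setT (fun t : R => gauss_exp n (fun g => f (scons t g))).
Proof.
move=> mf f0; apply: (@measurable_gauss_exp n _ _ (fun z => f (scons z.1 z.2))) => //.
by apply: (measurableT_comp mf); exact: measurable_scons.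
Qed.

Lemma measurable_scons_l (f : rseq -> \bar R) t :
  measurable_fun setT f -> measurable_fun setT (fun g : rseq => f (scons t g)).
Proof.
move=> mf; apply: (@measurable_fun_pair2 _ _ _ _ _ _ (fun z : R * rseq => f (scons z.1 z.2))).
by apply: (measurableT_comp mf); exact: measurable_scons.
Qed.

Lemma gauss_integrand_measurable n (f : rseq -> \bar R) :
  measurable_fun setT f -> (forall z, 0 <= f z) ->
  measurable_fun setT (fun t : R => (phi t)%:E * gauss_exp n (fun g => f (scons t g))).
Proof.
by move=> mf f0; apply: emeasurable_funM => //; exact: measurable_gauss_exp_scons.
Qed.

Lemma gauss_integrand_ge0 n (f : rseq -> \bar R) t : (forall z, 0 <= f z) ->
  0 <= (phi t)%:E * gauss_exp n (fun g => f (scons t g)).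
Proof.
move=> f0; apply: mule_ge0; first by rewrite lee_fin normal_pdf_ge0.
exact: gauss_exp_ge0.
Qed.

Lemma le_gauss_exp n (f1 f2 : rseq -> \bar R) :
  measurable_fun setT f1 -> measurable_fun setT f2 ->
  (forall z, 0 <= f1 z) -> (forall z, f1 z <= f2 z) ->
  gauss_exp n f1 <= gauss_exp n f2.
Proof.
elim: n f1 f2 => [|n IH] f1 f2 mf1 mf2 f10 f12 //=.
have f20 z : 0 <= f2 z by apply: le_trans (f12 z).
apply: ge0_le_integral => //.
- by move=> t _; exact: gauss_integrand_ge0.
- exact: gauss_integrand_measurable.
- exact: gauss_integrand_measurable.
- move=> t _; apply: lee_wpmul2l; first by rewrite lee_fin normal_pdf_ge0.
  by apply: IH => //; exact: measurable_scons_l.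
Qed.

Lemma gauss_expD n (f1 f2 : rseq -> \bar R) :
  measurable_fun setT f1 -> measurable_fun setT f2 ->
  (forall z, 0 <= f1 z) -> (forall z, 0 <= f2 z) ->
  gauss_exp n (fun g => f1 g + f2 g) = gauss_exp n f1 + gauss_exp n f2.
Proof.
elim: n f1 f2 => [|n IH] f1 f2 mf1 mf2 f10 f20 //=.
rewrite -ge0_integralD//.
- apply: eq_integral => t _; rewrite -ge0_muleDr ?gauss_exp_ge0//.
  by congr (_ * _); apply: IH => //; exact: measurable_scons_l.
- by move=> t _; exact: gauss_integrand_ge0.
- exact: gauss_integrand_measurable.
- by move=> t _; exact: gauss_integrand_ge0.
- exact: gauss_integrand_measurable.
Qed.

Lemma gauss_expZl n (c : R) (f : rseq -> \bar R) : (0 <= c)%R ->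
  measurable_fun setT f -> (forall z, 0 <= f z) ->
  gauss_exp n (fun g => c%:E * f g) = c%:E * gauss_exp n f.
Proof.
elim: n f => [|n IH] f c0 mf f0 //=.
rewrite -ge0_integralZl_EFin//.
- apply: eq_integral => t _; rewrite muleCA; congr (_ * _).
  by apply: IH => //; exact: measurable_scons_l.
- by move=> t _; exact: gauss_integrand_ge0.
- exact: gauss_integrand_measurable.
Qed.

Lemma gauss_exp_nneseries n (f : nat -> rseq -> \bar R) :
  (forall i, measurable_fun setT (f i)) -> (forall i z, 0 <= f i z) ->
  gauss_exp n (fun g => \sum_(0 <= i <oo) f i g) = \sum_(0 <= i <oo) gauss_exp n (f i).
Proof.
elim: n f => [|n IH] f mf f0 //=.
rewrite -integral_nneseries//.
- apply: eq_integral => t _; rewrite nneseriesZl//; last first.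
    by move=> i _; exact: gauss_exp_ge0.
  by congr (_ * _); apply: IH => // i; exact: measurable_scons_l.
- by move=> i; exact: gauss_integrand_measurable.
- by move=> i t _; exact: gauss_integrand_ge0.
Qed.

Lemma gauss_exp_cst n (c : R) : (0 <= c)%R -> gauss_exp n (fun=> c%:E) = c%:E.
Proof.
move=> c0; elim: n => [//|n /= ->].
under eq_integral do rewrite muleC.
rewrite ge0_integralZl_EFin//.
  by rewrite integral_normal_pdf mule1.
by move=> t _; rewrite lee_fin normal_pdf_ge0.
Qed.

End rseq.

(** * Changes of variables *)

Section substitution.
Variable R : realType.
Notation mu := (@lebesgue_measure R).
Local Open Scope ereal_scope.

(** Lebesgue measure is determined by the lengths of half-open intervals, which translations
    preserve. *)
Lemma lebesgue_measure_shift (h : R) (A : set R) : measurable A ->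
  pushforward mu (fun t : measurableTypeR R => (t + h)%R : measurableTypeR R) A = mu A.
Proof.
move=> mA.
have mh : measurable_fun setT
    (fun t : measurableTypeR R => (t + h)%R : measurableTypeR R).
  exact: measurable_funD.
pose nu : {measure set (measurableTypeR R) -> \bar R} :=
  measure_function_pushforward__canonical__measure_function_Measure mu mh.
apply/esym; apply: (@lebesgue_measure_unique R nu) => //= _ [[a b]] _ <-.
rewrite /nu /= /pushforward.
rewrite (_ : _ @^-1` _ = `](a - h)%R, (b - h)%R]%classic); last first.
  by apply/seteqP; split => x /=; rewrite !in_itv /= lerBrDr ltrBlDr.
rewrite !lebesgue_measure_itv /= !lte_fin ltrD2r; case: ifP => // _.
by rewrite -!EFinB; congr (_%:E); rewrite opprB addrA subrK.
Qed.

Lemma ge0_integral_shift (h : R) (f : R -> \bar R) :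
  measurable_fun setT f -> (forall t, 0 <= f t) ->
  \int[mu]_t f (t + h)%R = \int[mu]_t f t.
Proof.
move=> mf f0.
have mh : measurable_fun setT
    (fun t : measurableTypeR R => (t + h)%R : measurableTypeR R).
  exact: measurable_funD.
transitivity (\int[pushforward mu
    (fun t : measurableTypeR R => (t + h)%R : measurableTypeR R)]_t f t).
  by rewrite ge0_integral_pushforward.
apply: eq_measure_integral => A mA _; exact: lebesgue_measure_shift.
Qed.

Lemma ge0_integral_opp (f : R -> \bar R) :
  measurable_fun setT f -> (forall t, 0 <= f t) ->
  \int[mu]_t f (- t)%R = \int[mu]_t f t.
Proof.
move=> mf f0.
transitivity (\int[pushforward mu (-%R : _ -> measurableTypeR R)]_t f t).
  by rewrite ge0_integral_pushforward.
apply: eq_measure_integral => A mA _; exact: lebesgue_measureN.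
Qed.

End substitution.

Section gauss_exp_transform.
Variable R : realType.
Notation mu := (@lebesgue_measure R).
Notation phi := (@normal_pdf R 0 1).
Local Open Scope ereal_scope.

Lemma normal_pdf01 (t : R) : phi t = (normal_peak 1 * expR (- (t ^+ 2 / 2)))%R.
Proof.
rewrite normal_pdfE ?oner_eq0// /normal_fun subr0 expr1n mulNr.
by rewrite -[(1 *+ 2)%R]/(2%R : R).
Qed.

Lemma normal_pdfN (t : R) : phi (- t)%R = phi t.
Proof. by rewrite !normal_pdf01 sqrrN. Qed.

Lemma normal_pdf_shift (t h : R) :
  phi (t + h)%R = (phi t * expR (- (h * t) - h ^+ 2 / 2))%R.
Proof.
rewrite !normal_pdf01 -[RHS]mulrA -expRD; congr (_ * expR _)%R; lra.
Qed.

Lemma scons_opp (t : R) g :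
  (fun i => - scons t g i)%R = scons (- t)%R (fun i => - g i)%R.
Proof. by apply/funext => -[]. Qed.

Lemma gauss_expN n (f : rseq R -> \bar R) :
  measurable_fun setT f -> (forall z, 0 <= f z) ->
  gauss_exp n (fun g => f (fun i => - g i)%R) = gauss_exp n f.
Proof.
elim: n f => [|n IH] f mf f0 /=.
  by congr f; apply/funext => i; rewrite oppr0.
rewrite -[RHS]ge0_integral_opp; last 2 first.
- exact: gauss_integrand_measurable.
- by move=> t; exact: gauss_integrand_ge0.
apply: eq_integral => t _; rewrite normal_pdfN; congr (_ * _).
rewrite -(IH (fun g => f (scons (- t)%R g))) //; last exact: measurable_scons_l.
by congr gauss_exp; apply/funext => g; rewrite scons_opp.
Qed.

Lemma measurable_linear_form n (h : nat -> R) :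
  measurable_fun setT (fun g : rseq R => \sum_(i < n) h i * g i)%R.
Proof.
apply: measurable_sum => i; apply: measurable_funM => //.
exact: measurable_coord.
Qed.

(** Cameron-Martin density of the law of [g - h] with respect to the law of the standard Gaussian
    [g], in the first [n] coordinates. *)
Definition cm_density n (h g : nat -> R) : R :=
  expR (- (\sum_(i < n) h i * g i) - (\sum_(i < n) h i ^+ 2) / 2).

Lemma measurable_cm_density n (h : nat -> R) :
  measurable_fun setT (fun g : rseq R => cm_density n h g).
Proof.
rewrite /cm_density; apply: measurableT_comp => //; apply: measurable_funB => //.
by apply: measurableT_comp => //; exact: measurable_linear_form.
Qed.

Lemma cm_densityS n (h g : nat -> R) t :
  cm_density n.+1 h (scons t g) =
  (expR (- (h 0%N * t) - h 0%N ^+ 2 / 2) * cm_density n (fun i => h i.+1) g)%R.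
Proof. by rewrite /cm_density -expRD !big_ord_recl /=; congr expR; lra. Qed.

(** One coordinate at a time, translating the integration variable moves the shift onto
    [normal_pdf], and [normal_pdf_shift] gives the ratio. Since [h] vanishes from [n] on, the zero
    tail used by [gauss_exp] is left in place. *)
Lemma gauss_exp_shift n (h : nat -> R) (f : rseq R -> \bar R) :
  (forall i, (n <= i)%N -> h i = 0%R) ->
  measurable_fun setT f -> (forall z, 0 <= f z) ->
  gauss_exp n (fun g => f (fun i => g i - h i)%R) =
  gauss_exp n (fun g => (cm_density n h g)%:E * f g).
Proof.
elim: n h f => [|n IH] h f h0 mf f0 /=.
  rewrite /cm_density !big_ord0 mul0r oppr0 addr0 expR0 mul1e.
  by congr f; apply/funext => i; rewrite h0// subr0.
have mF : measurable_fun setT (fun g : rseq R => (cm_density n.+1 h g)%:E * f g).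
  apply: emeasurable_funM => //; apply/measurable_EFinP.
  exact: measurable_cm_density.
have F0 g : 0 <= (cm_density n.+1 h g)%:E * f g.
  by apply: mule_ge0 => //; rewrite lee_fin expR_ge0.
pose k t := gauss_exp n (fun g => (cm_density n (fun i => h i.+1) g)%:E * f (scons t g)).
have mk : measurable_fun setT k.
  apply: (@measurable_gauss_exp _ n _ _
    (fun z => (cm_density n (fun i => h i.+1) z.2)%:E * f (scons z.1 z.2))).
  - apply: emeasurable_funM.
      apply/measurable_EFinP.
      exact: (measurableT_comp (measurable_cm_density n (fun i => h i.+1)) measurable_snd).
    by apply: (measurableT_comp mf); exact: measurable_scons.
  - by move=> z; apply: mule_ge0 => //; rewrite lee_fin expR_ge0.
have k0 t : 0 <= k t.
  by apply: gauss_exp_ge0 => g; apply: mule_ge0 => //; rewrite lee_fin expR_ge0.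
transitivity (\int[mu]_t ((phi t)%:E * k (t - h 0%N)%R)).
  apply: eq_integral => t _; congr (_ * _); rewrite /k.
  rewrite -(IH (fun i => h i.+1) (fun g => f (scons (t - h 0%N)%R g))) //.
  - congr gauss_exp; apply/funext => g; congr f.
    by apply/funext => -[].
  - by move=> i ni; exact: h0.
  - exact: measurable_scons_l.
rewrite -[LHS](@ge0_integral_shift R (h 0%N)); last 2 first.
- apply: emeasurable_funM.
    by apply/measurable_EFinP; exact: measurable_normal_pdf.
  by apply: (measurableT_comp mk); exact: measurable_funB.
- by move=> t; apply: mule_ge0 => //; rewrite lee_fin normal_pdf_ge0.
apply: eq_integral => t _; rewrite addrK normal_pdf_shift EFinM -muleA.
congr (_ * _); rewrite /k -gauss_expZl ?expR_ge0//.
- by congr gauss_exp; apply/funext => g; rewrite muleA -EFinM cm_densityS.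
- apply: emeasurable_funM; last exact: measurable_scons_l.
  by apply/measurable_EFinP; exact: measurable_cm_density.
- by move=> g; apply: mule_ge0 => //; rewrite lee_fin expR_ge0.
Qed.

End gauss_exp_transform.

(** * The Gaussian measure on sequences *)

Section rseq_measures.
Variable R : realType.
Local Open Scope ereal_scope.

Definition box (B : nat -> set R) : set (rseq R) := [set g | forall i, B i (g i)].

Lemma measurable_box (B : nat -> set R) :
  (forall i, measurable (B i)) -> measurable (box B).
Proof.
move=> mB; rewrite (_ : box B = \bigcap_i [set g : rseq R | B i (g i)]).
  apply: bigcapT_measurable => i.
  by have := @measurable_coord R i measurableT _ (mB i); rewrite setTI.
by apply/seteqP; split => g /= Bg i; [move=> _; exact: Bg | exact: Bg i I].
Qed.

(** Boxes are stable under intersection and generate the sigma-algebra, so the pi-lambda principle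
    for finite measures applies. *)
Lemma rseq_measure_unique (m1 m2 : {measure set (rseq R) -> \bar R}) :
  m1 setT < +oo ->
  (forall B, (forall i, measurable (B i)) -> m1 (box B) = m2 (box B)) ->
  forall A, measurable A -> m1 A = m2 A.
Proof.
move=> m1T m12.
pose G : set (set (rseq R)) :=
  [set A | exists B, (forall i, measurable (B i)) /\ A = box B].
apply: (measure_unique G (fun=> setT)) => //.
- apply/seteqP; split.
    apply: smallest_sub; first exact: smallest_sigma_algebra.
    move=> _ [i [B [mB ->]]]; apply: sub_sigma_algebra.
    exists (fun j => if j == i then B else setT); split.
      by move=> j; case: ifP.
    apply/seteqP; split => g /=.
      by move=> Bg j; case: eqP => [->|].
    by move=> /(_ i); rewrite eqxx.
  apply: smallest_sub; first exact: sigma_algebra_measurable.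
  by move=> _ [B [mB ->]]; exact: measurable_box.
- move=> _ _ [B [mB ->]] [B' [mB' ->]].
  exists (fun i => B i `&` B' i); split.
    by move=> i; exact: measurableI.
  apply/seteqP; split => g /=; first by move=> [h1 h2] i; split; [exact: h1|exact: h2].
  by move=> h; split => i; have [] := h i.
- move=> _; exists (fun=> setT); split => //.
  by apply/seteqP; split.
- by apply/seteqP; split => // g _; exists 0%N.
- by move=> _ [B [mB ->]]; exact: m12.
Qed.

Definition gauss_measure (n : nat) (A : set (rseq R)) : \bar R :=
  gauss_exp n (fun g => (\1_A g)%:E).

Section instance.
Variable n : nat.

Let gauss_measure0 : gauss_measure n set0 = 0.
Proof.
rewrite /gauss_measure (_ : (fun g => _) = fun=> 0%:E) ?gauss_exp_cst//.
by apply/funext => g; rewrite indic0.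
Qed.

Let gauss_measure_ge0 A : 0 <= gauss_measure n A.
Proof. by apply: gauss_exp_ge0 => g; rewrite lee_fin. Qed.

Let gauss_measure_sigma_additive : semi_sigma_additive (gauss_measure n).
Proof.
move=> F mF tF mUF.
rewrite [X in _ --> X](_ : _ = \sum_(0 <= i <oo) gauss_measure n (F i)).
  by apply: is_cvg_ereal_nneg_natsum_cond => i _ _; exact: gauss_measure_ge0.
rewrite /gauss_measure -gauss_exp_nneseries.
- congr gauss_exp; apply/funext => g.
  (* For fixed [g], additivity of indicators over disjoint sets is sigma-additivity of the Dirac
     measure at [g]. *)
  transitivity (@dirac _ (rseq R) g R (\bigcup_i F i)); first by rewrite diracE indicE.
  rewrite measure_bigcup//=; under eq_eseriesl do rewrite in_setT.
  by apply: eq_eseriesr => i _; rewrite diracE indicE.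
- by move=> i; apply/measurable_EFinP; exact: measurable_indic.
- by move=> i g; rewrite lee_fin.
Qed.

HB.instance Definition _ := isMeasure.Build _ _ _ (gauss_measure n)
  gauss_measure0 gauss_measure_ge0 gauss_measure_sigma_additive.

End instance.

Lemma gauss_measureT n : gauss_measure n setT = 1.
Proof.
rewrite /gauss_measure (_ : (fun g => _) = fun=> 1%:E) ?gauss_exp_cst//.
by apply/funext => g; rewrite indicT.
Qed.

(** The indicator accounts for the tail: the measure lives on sequences vanishing from index [n] on,
    so a box whose later factors miss 0 is null. *)
Lemma gauss_measure_box n (B : nat -> set R) : (forall i, measurable (B i)) ->
  gauss_measure n (box B) =
  ((\prod_(i < n) fine (normal_prob 0 1 (B i))) *
   \1_(box (fun i => B (n + i)%N)) (fun=> 0))%:E.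
Proof.
elim: n B => [|n IH] B mB.
  by rewrite /gauss_measure /= big_ord0 mul1r.
rewrite /gauss_measure /=.
have indE t g : (\1_(box B) (scons t g) : R)%:E =
    (\1_(B 0%N) t)%:E * (\1_(box (fun i => B i.+1)) g)%:E.
  rewrite -EFinM !indicE -natrM mulnb; congr (_%:R%:E).
  congr nat_of_bool; apply/idP/andP.
    move=> /set_mem Bg; split; apply/mem_set; first exact: (Bg 0%N).
    by move=> i; exact: (Bg i.+1).
  by move=> [/set_mem B0 /set_mem Bg]; apply/mem_set => -[|i] //=; exact: Bg.
pose cn := (\prod_(i < n) fine (normal_prob 0 1 (B i.+1)) *
   \1_(box (fun i => B (n + i).+1)) (fun=> 0))%R.
transitivity (\int[lebesgue_measure]_t (cn%:E * ((normal_pdf 0 1 t)%:E * (\1_(B 0%N) t)%:E))).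
  apply: eq_integral => t _.
  rewrite (_ : (fun g => _) = fun g => (\1_(B 0%N) t)%:E *
      (\1_(box (fun i => B i.+1)) g)%:E); last by apply/funext => g; exact: indE.
  rewrite gauss_expZl//.
    rewrite -/(gauss_measure n _) IH//.
    by rewrite muleA muleC.
  apply/measurable_EFinP; apply: measurable_indic; apply: measurable_box => i.
  exact: mB.
have cn0 : (0 <= cn)%R.
  apply: mulr_ge0 => //; apply: prodr_ge0 => i _; apply: fine_ge0.
  exact: measure_ge0.
rewrite (ge0_integralZl_EFin _ _ _ _ cn0)//; last 2 first.
- by move=> t _; rewrite -EFinM lee_fin mulr_ge0// normal_pdf_ge0.
- apply: emeasurable_funM.
    by apply/measurable_EFinP; exact: measurable_normal_pdf.
  have mI : measurable_fun setT (\1_(B 0%N) : R -> R) by exact: measurable_indic.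
  by apply/measurable_EFinP.
rewrite big_ord_recl /= mulrC.
have -> : \int[lebesgue_measure]_t ((normal_pdf 0 1 t)%:E * (\1_(B 0%N) t)%:E) =
    (fine (normal_prob 0 1 (B 0%N)))%:E.
  rewrite fineK; last by apply: (@fin_num_measure _ _ _ (normal_prob 0 1)); exact: mB.
  rewrite /normal_prob [RHS]integral_mkcond; apply: eq_integral => t _.
  rewrite patchE indicE; case: ifP => _; by rewrite ?mule1 ?mule0.
by rewrite -EFinM /cn; congr (_%:E); ring.
Qed.

End rseq_measures.

(** * Gaussian width and concentration *)

Section first_moment.
Variable R : realType.
Notation mu := (@lebesgue_measure R).
Notation phi := (@normal_pdf R 0 1).
Local Open Scope ereal_scope.

(** Since [|t| <= 1 + t^2 / 4 <= exp (t^2 / 4)], the factor [|t|] costs only a doubling of the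
    variance. *)
Lemma abs_normal_pdf_le (t : R) : (`|t| * phi t <=
  normal_peak 1 / normal_peak (Num.sqrt 2) * normal_pdf 0 (Num.sqrt 2) t)%R.
Proof.
have s2 : (Num.sqrt 2 != 0 :> R)%R by rewrite gt_eqF// sqrtr_gt0.
rewrite normal_pdf01 normal_pdfE// /normal_fun subr0 sqr_sqrtr//.
rewrite mulrA divfK ?gt_eqF ?normal_peak_gt0//.
rewrite mulrCA ler_pM2l ?normal_peak_gt0 ?oner_eq0//.
rewrite -(_ : (expR (t ^+ 2 / 4) * expR (- (t ^+ 2 / 2)))%R =
    expR (- t ^+ 2 / (2 *+ 2))); last first.
  by rewrite -expRD; congr expR; rewrite -mulr_natr; lra.
apply: ler_wpM2r; first exact: expR_ge0.
apply: le_trans (expR_ge1Dx _).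
rewrite -(real_normK (num_real t)).
have := sqr_ge0 (`|t| / 2 - 1)%R; nra.
Qed.

Lemma integrable_mul_normal_pdf :
  mu.-integrable setT (fun t : R => (t * phi t)%:E).
Proof.
have s2 : (Num.sqrt 2 != 0 :> R)%R by rewrite gt_eqF// sqrtr_gt0.
set c := (normal_peak 1 / normal_peak (Num.sqrt 2) : R)%R.
apply: (@le_integrable _ _ _ mu _ measurableT _
    (fun t : R => c%:E * (normal_pdf 0 (Num.sqrt 2) t)%:E)).
- apply/measurable_EFinP; apply: measurable_funM => //.
  exact: measurable_normal_pdf.
- move=> t _; rewrite -EFinM /= lee_fin normrM.
  rewrite (ger0_norm (normal_pdf_ge0 _ _ _)).
  by apply: le_trans (abs_normal_pdf_le t) _; exact: ler_norm.
- by apply: integrableZl => //; exact: integrable_normal_pdf.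
Qed.

Lemma integral_mul_normal_pdf : \int[mu]_t (t * phi t)%:E = 0.
Proof.
set f := (fun t : R => (t * phi t)%:E).
have intf : mu.-integrable setT f by exact: integrable_mul_normal_pdf.
rewrite integralE; set a := \int[mu]_t _; set b := \int[mu]_t _.
have ab : a = b.
  rewrite /a /b -[LHS]ge0_integral_opp.
  - apply: eq_integral => t _; rewrite funeposE funenegE /f.
    by rewrite normal_pdfN mulNr EFinN.
  - by apply: measurable_funepos; exact: measurable_int intf.
  - by move=> t; exact: funepos_ge0.
rewrite ab subee//.
exact: integrable_neg_fin_num.
Qed.

Definition gauss_abs : R := fine (\int[mu]_t (`|t| * phi t)%:E).

Lemma gauss_absE : \int[mu]_t (`|t| * phi t)%:E = gauss_abs%:E.
Proof.
rewrite /gauss_abs fineK//; apply: integrable_fin_num => //.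
apply: (@le_integrable _ _ _ mu _ measurableT _ (fun t : R => (t * phi t)%:E)).
- apply/measurable_EFinP; apply: measurable_funM.
    exact: normr_measurable.
  exact: measurable_normal_pdf.
- by move=> t _; rewrite /= lee_fin !normrM normr_id.
- exact: integrable_mul_normal_pdf.
Qed.

Lemma gauss_abs_ge0 : (0 <= gauss_abs)%R.
Proof.
apply: fine_ge0; apply: integral_ge0 => t _.
by rewrite lee_fin mulr_ge0// normal_pdf_ge0.
Qed.

(** The affine form of the bound survives fixing a coordinate, whose contribution joins [A]. Later
    uses only need the finiteness that it gives. *)
Lemma gauss_exp_growth n (A B : R) (u : rseq R -> \bar R) :
  (0 <= A)%R -> (0 <= B)%R ->
  measurable_fun setT u -> (forall g, 0 <= u g) ->
  (forall g, u g <= (A + B * \sum_(i < n) `|g i|)%:E) ->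
  gauss_exp n u <= (A + B * (n%:R * gauss_abs))%:E.
Proof.
elim: n A u => [|n IH] A u A0 B0 mu_ u0 uB /=.
  by have := uB (fun=> 0%R); rewrite big_ord0 mulr0 mul0r mulr0.
pose c := (A + B * (n%:R * gauss_abs))%R.
have c0 : (0 <= c)%R by rewrite addr_ge0// mulr_ge0// mulr_ge0// gauss_abs_ge0.
have -> : (A + B * (n.+1%:R * gauss_abs))%:E = c%:E * \int[mu]_t (phi t)%:E +
    B%:E * \int[mu]_t (`|t| * phi t)%:E.
  rewrite integral_normal_pdf gauss_absE -!EFinM -EFinD mulr1 /c.
  by congr (_%:E); rewrite -natr1; ring.
have mphi : measurable_fun [set: R] (EFin \o phi).
  by apply/measurable_EFinP; exact: measurable_normal_pdf.
have mabs : measurable_fun [set: R] (fun t => (`|t| * phi t)%:E).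
  apply/measurable_EFinP; apply: measurable_funM; first exact: normr_measurable.
  exact: measurable_normal_pdf.
have phi0 t : 0 <= (phi t)%:E by rewrite lee_fin normal_pdf_ge0.
have abs0 t : 0 <= (`|t| * phi t)%:E by rewrite lee_fin mulr_ge0// normal_pdf_ge0.
rewrite -!ge0_integralZl_EFin// -ge0_integralD//; last 4 first.
- by move=> t _; rewrite mule_ge0.
- by apply: emeasurable_funM.
- by move=> t _; rewrite mule_ge0.
- by apply: emeasurable_funM.
apply: ge0_le_integral => //.
- by move=> t _; exact: gauss_integrand_ge0.
- exact: gauss_integrand_measurable.
- by apply: emeasurable_funD; apply: emeasurable_funM.
move=> t _.
have : gauss_exp n (fun g => u (scons t g)) <= (A + B * `|t| + B * (n%:R * gauss_abs))%:E.
  apply: IH => //.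
  - by rewrite addr_ge0// mulr_ge0.
  - exact: measurable_scons_l.
  - move=> g; apply: le_trans (uB _) _; rewrite lee_fin big_ord_recl /=.
    by rewrite mulrDr addrA.
move=> /(lee_wpmul2l (phi0 t)) /le_trans; apply.
by rewrite -!EFinM -EFinD lee_fin /c le_eqVlt; apply/orP; left; apply/eqP; ring.
Qed.

(** The linear form is centred, but the sum may change sign, so additivity for nonnegative functions
    does not apply; the growth bound supplies integrability at each level of the iterated integral.
    This is what makes the width invariant under translation. *)
Lemma gauss_exp_affine n (x : nat -> R) (c A B : R) (u : rseq R -> \bar R) :
  (0 <= A)%R -> (0 <= B)%R ->
  measurable_fun setT u -> (forall g, 0 <= u g) ->
  (forall g, u g <= (A + B * \sum_(i < n) `|g i|)%:E) ->
  gauss_exp n (fun g => u g + (\sum_(i < n) g i * x i + c)%:E) =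
  gauss_exp n u + c%:E.
Proof.
elim: n x c A u => [|n IH] x c A u A0 B0 mu_ u0 uB /=.
  by rewrite big_ord0 add0r.
pose G t := gauss_exp n (fun g => u (scons t g)).
have uBt t g : u (scons t g) <= (A + B * `|t| + B * \sum_(i < n) `|g i|)%:E.
  by apply: le_trans (uB _) _; rewrite lee_fin big_ord_recl /= mulrDr addrA.
have G0 t : 0 <= G t by exact: gauss_exp_ge0.
have Gfin t : G t \is a fin_num.
  rewrite ge0_fin_numE//; apply: le_lt_trans (ltry (A + B * `|t| + B * (n%:R * gauss_abs))).
  apply: gauss_exp_growth => //.
  - by rewrite addr_ge0// mulr_ge0.
  - exact: measurable_scons_l.
have intG : mu.-integrable setT (fun t => (phi t)%:E * G t).
  apply/integrableP; split; first exact: gauss_integrand_measurable.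
  under eq_integral do rewrite gee0_abs ?gauss_integrand_ge0//.
  apply: le_lt_trans (ltry (A + B * (n.+1%:R * gauss_abs))).
  exact: (@gauss_exp_growth n.+1).
have intx : mu.-integrable setT (fun t => (x 0%N)%:E * (t * phi t)%:E).
  by apply: integrableZl => //; exact: integrable_mul_normal_pdf.
have intc : mu.-integrable setT (fun t => c%:E * (phi t)%:E).
  by apply: integrableZl => //; exact: integrable_normal_pdf.
transitivity (\int[mu]_t ((phi t)%:E * G t + ((x 0%N)%:E * (t * phi t)%:E + c%:E * (phi t)%:E))).
  apply: eq_integral => t _.
  rewrite (_ : gauss_exp n _ = G t + (t * x 0%N + c)%:E); last first.
    (* Once the first coordinate is fixed, [t * x 0] is part of the constant and [B |t|] part of the
       growth bound. *)
    rewrite -(IH (fun i => x i.+1) (t * x 0%N + c)%R (A + B * `|t|)%R) //.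
    - congr gauss_exp; apply/funext => g; congr (_ + _%:E).
      by rewrite big_ord_recl /=; ring.
    - by rewrite addr_ge0// mulr_ge0.
    - exact: measurable_scons_l.
  rewrite -(fineK (Gfin t)) -[(fine _)%:E + _]EFinD -!EFinM -!EFinD.
  by congr (_%:E); ring.
rewrite integralD//; last exact: integrableD.
rewrite integralD// !integralZl//.
- rewrite integral_mul_normal_pdf integral_normal_pdf mule0 add0e mule1 //.
- exact: integrable_normal_pdf.
- exact: integrable_mul_normal_pdf.
Qed.

End first_moment.

Section sup_form.
Variable R : realType.

(** Such a set is the union of the boxes with rational centres and radii [1 / (m + 1)] that it
    contains, and there are countably many of them. *)
Lemma open_rseq_measurable (n : nat) (U : set (rseq R)) :
  (forall g, U g -> exists2 e : R, 0 < e &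
     forall g', (forall i, (i < n)%N -> `|g' i - g i| < e) -> U g') ->
  measurable U.
Proof.
move=> Uop.
pose B (z : seq rat * nat) i : set R :=
  if (i < n)%N then [set t | `|t - ratr z.1`_i| < z.2.+1%:R^-1] else setT.
have mB z : measurable (box (B z)).
  apply: measurable_box => i; rewrite /B; case: ifP => // _.
  set a := ratr _; set e := _^-1.
  rewrite (_ : [set t | _] = `]a - e, a + e[%classic).
    exact: measurable_itv.
  by apply/seteqP; split => t /=; rewrite in_itv /= ltr_distl.
rewrite (_ : U = \bigcup_z (if `[< box (B z) `<=` U >] then box (B z) else set0)).
  apply: countable_bigcupT_measurable; first exact: countableP.
  by move=> z; case: ifP.
apply/seteqP; split => g; last first.
  by move=> [z _]; case: asboolP => // BU /BU.
move=> Ug; have [e e0 eU] := Uop g Ug.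
have [m me] : exists m : nat, (m.+1%:R^-1 : R) < e / 2.
  have e20 : 0 < e / 2 by rewrite divr_gt0.
  by have [m _ /(_ m (leqnn m))] := near_infty_natSinv_lt (PosNum e20); exists m.
have m0 : (0 : R) < m.+1%:R^-1 by rewrite invr_gt0.
have /choice[f fP] : forall i : nat, exists q : rat,
    ratr q \in `]g i - m.+1%:R^-1, g i + m.+1%:R^-1[.
  by move=> i; apply: rat_in_itvoo; rewrite ltrD2l gtrN.
exists (mkseq f n, m) => //.
have fE i : (i < n)%N -> `|g i - ratr (mkseq f n)`_i| < m.+1%:R^-1.
  move=> i_n; rewrite nth_mkseq//; have := fP i; rewrite in_itv /= => /andP[h1 h2].
  by rewrite ltr_distl ltrBlDr h2 -ltrBlDr h1.
case: asboolP => [_|[]].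
  by move=> i; rewrite /B /=; case: ifP => //= i_n; exact: fE.
move=> g' Bg'; apply: eU => i i_n.
have := Bg' i; rewrite /B i_n /= => h.
apply: le_lt_trans (ler_distD (ratr (mkseq f n)`_i) _ _) _.
rewrite (distrC _ (g i)) (splitr e); apply: ltrD; apply: lt_trans me => //.
exact: fE.
Qed.

Local Open Scope ereal_scope.

Definition sup_form (n : nat) (Y : set 'cV[R]_n) (g : nat -> R) : \bar R :=
  ereal_sup [set (\sum_(i < n) g i * y i 0)%R%:E | y in Y].

(** A supremum of continuous forms has open strict superlevel sets, so [Y] may be uncountable. *)
Lemma measurable_sup_form n (Y : set 'cV[R]_n) :
  measurable_fun setT (sup_form Y : rseq R -> \bar R).
Proof.
apply: (measurability _ (ErealGenOInfty.measurableE R)) => _ [_ [a ->]] <-.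
rewrite setTI; apply: (@open_rseq_measurable n) => g /=.
rewrite in_itv /= andbT => /ereal_sup_gt[_ [y Yy <-]]; rewrite lte_fin => ay.
set s := (\sum_(i < n) g i * y i 0)%R in ay.
(* The added 1 keeps [c] positive for [y = 0] and makes the final estimate strict. *)
pose c : R := (1 + \sum_(i < n) `|y i 0|)%R.
have c0 : (0 < c)%R by rewrite ltr_pwDl// sumr_ge0.
exists ((s - a) / c)%R; first by rewrite divr_gt0// subr_gt0.
move=> g' g'g; rewrite in_itv /= andbT.
apply: (@lt_le_trans _ _ (\sum_(i < n) g' i * y i 0)%R%:E); last first.
  by apply: ereal_sup_ubound; exists y.
rewrite lte_fin.
suff : (`|\sum_(i < n) g' i * y i 0 - s| < s - a)%R by rewrite ltr_distl; lra.
rewrite /s -sumrB.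
apply: le_lt_trans (ler_norm_sum _ _ _) _.
apply: (@le_lt_trans _ _ (\sum_(i < n) ((s - a) / c) * `|y i 0|)%R).
  apply: ler_sum => i _; rewrite -mulrBl normrM ler_wpM2r// ltW//.
  exact: g'g.
rewrite -mulr_sumr -[ltRHS]mulr1 -mulrA ltr_pM2l ?subr_gt0//.
by rewrite mulrC ltr_pdivrMr// mul1r /c ltrDr.
Qed.

Lemma sup_form_translate n (Y : set 'cV[R]_n) (x : 'cV[R]_n) g :
  sup_form Y g = sup_form [set y - x | y in Y]%R g + (\sum_(i < n) g i * x i 0)%R%:E.
Proof.
have E y : (\sum_(i < n) g i * (y - x) i 0 =
    \sum_(i < n) g i * y i 0 - \sum_(i < n) g i * x i 0)%R.
  by rewrite -sumrB; apply: eq_bigr => i _; rewrite !mxE mulrBr.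
apply/eqP; rewrite eq_le; apply/andP; split.
  apply: ge_ereal_sup => _ [y Yy <-].
  rewrite -leeBlDr// -EFinB -E; apply: ereal_sup_ubound.
  by exists (y - x)%R => //; exists y.
rewrite -leeBrDr//; apply: ge_ereal_sup => _ [_ [y Yy <-] <-].
by rewrite leeBrDr// -EFinD E subrK; apply: ereal_sup_ubound; exists y.
Qed.

Lemma sup_form_bound n (Y : set 'cV[R]_n) (b : R) g :
  (forall y i, Y y -> `|y i 0| <= b)%R ->
  sup_form Y g <= (0 + b * \sum_(i < n) `|g i|)%R%:E.
Proof.
move=> Yb; apply: ge_ereal_sup => _ [y Yy <-]; rewrite lee_fin add0r.
rewrite mulr_sumr; apply: le_trans (ler_norm _) _.
apply: le_trans (ler_norm_sum _ _ _) _; apply: ler_sum => i _.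
by rewrite normrM mulrC ler_wpM2r// Yb.
Qed.

(** Markov's inequality for the oscillation of the form over [T], whose expectation is [2 w] by the
    symmetry of [g]. The level [4 w + r] is at least twice that, and [r] keeps it positive when
    [w = 0]. *)
Lemma gaussian_width_concentration n (T : set 'cV[R]_n) (x0 : 'cV[R]_n) (b r : R) :
  T x0 -> (0 <= b)%R -> (forall y i, T y -> `|y i 0| <= b)%R -> (0 < r)%R ->
  (0 <= gaussian_width T)%R /\
  exists2 K : set (rseq R), measurable K &
    (2^-1)%:E <= gauss_measure n K /\
    forall g y z, K g -> T y -> T z ->
      (\sum_(i < n) g i * y i 0 - \sum_(i < n) g i * z i 0
        <= 4 * gaussian_width T + r)%R.
Proof.
move=> Tx0 b0 Tb r0.
(* Translating by a point of [T] makes the supremum nonnegative without changing its expectation. *)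
pose u := sup_form [set y - x0 | y in T]%R.
have mu : measurable_fun setT (u : rseq R -> \bar R) by exact: measurable_sup_form.
have u0 g : 0 <= u g.
  apply: ereal_sup_ubound; exists 0%R; first by exists x0 => //; rewrite subrr.
  by congr (_%:E); apply: big1 => i _; rewrite mxE mulr0.
have uB g : u g <= (0 + (b + b) * \sum_(i < n) `|g i|)%R%:E.
  apply: sup_form_bound => _ i [y Ty <-]; rewrite !mxE.
  by apply: le_trans (ler_normB _ _) _; apply: lerD; exact: Tb.
have bb0 : (0 <= b + b)%R by exact: addr_ge0.
have Eu : gauss_exp n u = (gaussian_width T)%:E.
  have finu : gauss_exp n u \is a fin_num.
    rewrite ge0_fin_numE ?gauss_exp_ge0//.
    by apply: le_lt_trans (gauss_exp_growth _ _ _ _ uB) (ltry _).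
  rewrite /gaussian_width -(_ : gauss_exp n u = gauss_exp n (sup_form T)) ?fineK//.
  pose x i := (if insub i is Some j then x0 j 0 else 0)%R.
  have xE (i : 'I_n) : (x i = x0 i 0)%R by rewrite /x valK.
  rewrite -[LHS]adde0 -(gauss_exp_affine x 0 _ _ _ _ uB)//.
  congr gauss_exp; apply/funext => g; rewrite (sup_form_translate _ x0) addr0.
  by congr (_ + _%:E); apply: eq_bigr => i _; rewrite xE.
set w := gaussian_width T in Eu *.
have w0 : (0 <= w)%R by rewrite -lee_fin -Eu gauss_exp_ge0.
split=> //.
pose V (g : rseq R) := u g + u (fun i => - g i)%R.
have muN : measurable_fun setT (fun g : rseq R => u (fun i => - g i)%R).
  apply: (measurableT_comp mu (g := fun g : rseq R => (fun i => - g i)%R : rseq R)).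
  apply: measurable_to_rseq => i; apply: measurableT_comp => //.
  exact: measurable_coord.
have mV : measurable_fun setT V by exact: emeasurable_funD.
have V0 g : 0 <= V g by exact: adde_ge0.
have EV : gauss_exp n V = (2 * w)%:E.
  by rewrite gauss_expD// gauss_expN// Eu -EFinD mulr2n mulrDl mul1r.
pose L0 := (4 * w + r)%R.
have L00 : (0 < L0)%R by rewrite ltr_wpDl// mulr_ge0.
pose K := [set g : rseq R | V g <= L0%:E].
have mK : measurable K.
  by rewrite -[K]setTI; exact: emeasurable_fun_infty_c.
exists K => //; split.
  have KC : gauss_measure n (~` K) <= (2^-1)%:E.
    have : L0%:E * gauss_measure n (~` K) <= (2 * w)%:E.
      rewrite -EV /gauss_measure -gauss_expZl//; last 2 first.
      - exact: ltW.
      - by apply/measurable_EFinP; apply: measurable_indic; exact: measurableC.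
      apply: le_gauss_exp => //.
      - apply: emeasurable_funM => //.
        by apply/measurable_EFinP; apply: measurable_indic; exact: measurableC.
      - by move=> g; rewrite -EFinM lee_fin mulr_ge0// ltW.
      - move=> g; rewrite indicE; case: (boolP (g \in _)) => [|_].
          by rewrite inE mule1 => /negP; rewrite -ltNge => /ltW.
        by rewrite mule0.
    have fK : gauss_measure n (~` K) \is a fin_num.
      rewrite ge0_fin_numE//; apply: le_lt_trans (ltry 1).
      rewrite -(gauss_measureT R n); apply: le_measure => //; rewrite inE//.
      exact: measurableC.
    rewrite -(fineK fK) -EFinM !lee_fin => h.
    rewrite -(ler_pM2l L00); apply: le_trans h _; rewrite /L0; lra.
  have : gauss_measure n K + gauss_measure n (~` K) = 1.
    rewrite -measureU//; last 2 first.
    - exact: measurableC.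
    - by rewrite setICr.
    by rewrite setUv; exact: gauss_measureT.
  move=> KK.
  have -> : gauss_measure n K = 1 - gauss_measure n (~` K).
    rewrite -KK addeK// ge0_fin_numE//; exact: le_lt_trans KC (ltry _).
  rewrite leeBrDl; last first.
    by rewrite ge0_fin_numE//; exact: le_lt_trans KC (ltry _).
  apply: le_trans (leeD KC (lexx _)) _.
  by rewrite -EFinD lee_fin; lra.
move=> g y z Kg Ty Tz; rewrite -lee_fin; apply: le_trans Kg.
have -> : (\sum_(i < n) g i * y i 0 - \sum_(i < n) g i * z i 0 =
   \sum_(i < n) g i * (y - x0)%R i 0 + \sum_(i < n) (- g i) * (z - x0)%R i 0)%R.
  by rewrite -sumrB -big_split; apply: eq_bigr => i _; rewrite !mxE /=; ring.
rewrite EFinD; apply: leeD; apply: ereal_sup_ubound.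
  by exists (y - x0)%R => //; exists y.
by exists (z - x0)%R => //; exists z.
Qed.

End sup_form.

(** * Independence of the neurons *)

Section independence.
Context (dO : measure_display) (O : measurableType dO) (R : realType)
  (P : probability O R).

Let measurable_preimage (f : O -> rseq R) (A : set (rseq R)) :
  measurable_fun setT f -> measurable A -> measurable (f @^-1` A).
Proof. by move=> mf mA; rewrite -[X in measurable X]setTI; exact: mf. Qed.

(** Boxes are replaced by arbitrary sets one index at a time: with the other sets fixed, both sides
    are finite measures in the remaining set, and they agree on boxes. *)
Lemma rseq_mutually_independent (J : finType) (Y : J -> O -> rseq R) :
  (forall i, measurable_fun setT (Y i)) ->
  (forall B : J -> nat -> set R, (forall i j, measurable (B i j)) ->
    fine (P (\bigcap_i (Y i @^-1` box (B i)))) =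
    \prod_i fine (P (Y i @^-1` box (B i)))) ->
  forall A : J -> set (rseq R), (forall i, measurable (A i)) ->
    fine (P (\bigcap_i (Y i @^-1` A i))) = \prod_i fine (P (Y i @^-1` A i)).
Proof.
move=> mY Ybox.
pose isbox (A : set (rseq R)) :=
  exists B, (forall j : nat, measurable (B j : set R)) /\ A = box B.
(* The list [s] collects the indices where the set is already arbitrary. *)
suff H (s : seq J) (A : J -> set (rseq R)) : (forall i, measurable (A i)) ->
    (forall i, i \notin s -> isbox (A i)) ->
    fine (P (\bigcap_i (Y i @^-1` A i))) = \prod_i fine (P (Y i @^-1` A i)).
  by move=> A mA; apply: (H (enum J)) => // i; rewrite mem_enum.
elim: s A => [|i0 s IH] A mA Abox.
  have /choice[B BP] : forall i, exists B : nat -> set R,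
    (forall j : nat, measurable (B j : set R)) /\ A i = box B by move=> i; exact: Abox.
  rewrite (_ : A = fun i => box (B i)); last by apply/funext => i; have [] := BP i.
  by apply: Ybox => i j; have [/(_ j)] := BP i.
pose upd E i := if i == i0 then E else A i.
pose D := \bigcap_(i in [set i | i != i0]) (Y i @^-1` A i).
have mD : measurable D.
  apply: fin_bigcap_measurable; first exact: finite_finset.
  by move=> i _; exact: measurable_preimage.
have capE E : \bigcap_i (Y i @^-1` upd E i) = Y i0 @^-1` E `&` D.
  apply/seteqP; split => om /=.
    move=> h; split; first by have := h i0 I; rewrite /upd eqxx.
    by move=> i /= ii0; have := h i I; rewrite /upd (negbTE ii0).
  move=> [h0 h] i _; rewrite /upd; case: eqP => [->//|/eqP ii0].
  exact: h.
have prodE E : \prod_i fine (P (Y i @^-1` upd E i)) =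
    fine (P (Y i0 @^-1` E)) * \prod_(i | i != i0) fine (P (Y i @^-1` A i)).
  rewrite (bigD1 i0)//= /upd eqxx; congr (_ * _).
  by apply: eq_bigr => i /negbTE ->.
have IHE E : measurable E -> isbox E ->
    fine (P (Y i0 @^-1` E `&` D)) =
    fine (P (Y i0 @^-1` E)) * \prod_(i | i != i0) fine (P (Y i @^-1` A i)).
  move=> mE bE; rewrite -capE -prodE; apply: IH.
    by move=> i; rewrite /upd; case: ifP.
  move=> i si; rewrite /upd; case: eqP => // /eqP ii0.
  by apply: Abox; rewrite inE negb_or ii0.
(* The whole space is a box, so it may stand at index [i0]. *)
have PD : fine (P D) = \prod_(i | i != i0) fine (P (Y i @^-1` A i)).
  have := IHE setT measurableT; rewrite preimage_setT setTI probability_setT mul1r.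
  apply; exists (fun=> setT); split => //; by apply/seteqP; split.
pose m1 : {measure set (rseq R) -> \bar R} :=
  measure_function_pushforward__canonical__measure_function_Measure (mrestr P mD) (mY i0).
have PD0 : 0 <= fine (P D) by exact: fine_ge0.
pose m2 : {measure set (rseq R) -> \bar R} :=
  mscale (NngNum PD0) (measure_function_pushforward__canonical__measure_function_Measure P (mY i0)).
have m1E E : m1 E = P (Y i0 @^-1` E `&` D) by [].
have m2E E : m2 E = ((fine (P D))%:E * P (Y i0 @^-1` E))%E by [].
have finP (X : set O) : measurable X -> P X \is a fin_num.
  by move=> mX; exact: fin_num_measure.
have m12 E : measurable E -> m1 E = m2 E.
  apply: rseq_measure_unique.
    rewrite m1E ltey_eq finP//.
    by apply: measurableI => //; rewrite preimage_setT.
  move=> B mB; rewrite m1E m2E.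
  have mbB := measurable_box mB.
  have mpB := measurable_preimage (mY i0) mbB.
  rewrite -(@fineK _ (P (_ `&` D))) ?finP//; last exact: measurableI.
  rewrite -(@fineK _ (P (Y i0 @^-1` box B))) ?finP// -EFinM; congr (_%:E).
  have bB : isbox (box B) by exists B.
  by rewrite (IHE _ mbB bB) -PD mulrC.
have -> : \bigcap_i (Y i @^-1` A i) = Y i0 @^-1` (A i0) `&` D.
  rewrite -capE; apply: eq_bigcapr => i _; rewrite /upd.
  by case: eqP => [->|].
have := m12 (A i0) (mA i0); rewrite m1E m2E => ->.
rewrite fineM ?finP//=; last exact: measurable_preimage.
by rewrite PD mulrC [RHS](bigD1 i0).
Qed.

End independence.

Section neurons.
Context (dO : measure_display) (O : measurableType dO) (R : realType)
  (P : probability O R) (n d : nat)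
  (W : 'I_n -> 'I_d -> {RV P >-> R}) (b : 'I_n -> {RV P >-> R}).

Definition params (ij : ('I_n * 'I_d + 'I_n)%type) : {RV P >-> R} :=
  match ij with inl p => W p.1 p.2 | inr i => b i end.

Definition weights (i : 'I_n) (om : O) : rseq R :=
  fun k => if insub k is Some j then W i j om else 0.

(* Coordinate 0 is the bias, the next [d] ones the weights, the rest is 0. *)
Definition neuron (i : 'I_n) (om : O) : rseq R := scons (b i om) (weights i om).

Definition param_row (ij : ('I_n * 'I_d + 'I_n)%type) : 'I_n :=
  match ij with inl p => p.1 | inr i => i end.
Definition param_col (ij : ('I_n * 'I_d + 'I_n)%type) : nat :=
  match ij with inl p => p.2.+1 | inr _ => 0%N end.

Lemma weightsE i om (j : 'I_d) : weights i om j = W i j om.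
Proof. by rewrite /weights valK. Qed.

Lemma weights_ge i om k : (d <= k)%N -> weights i om k = 0.
Proof. by move=> dk; rewrite /weights insubN// -leqNgt. Qed.

Lemma measurable_weights i : measurable_fun setT (weights i).
Proof.
apply: measurable_to_rseq => k; rewrite /weights.
by case: insubP => [j _ _|_]; [exact: measurable_funP|exact: measurable_cst].
Qed.

Lemma measurable_neuron i : measurable_fun setT (neuron i).
Proof.
apply: measurable_scons; [exact: measurable_funP|exact: measurable_weights].
Qed.

Hypothesis indep : mutually_independent params.

(** The padding coordinates of a neuron are constantly 0, so a box excluding 0 there has empty
    preimage; the product formulas treat that case apart. *)
Let pad_ok (B : nat -> set R) := forall k, (d <= k)%N -> B k.+1 0.

Lemma neuron_boxP i B om : (neuron i @^-1` box B) om <->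
  pad_ok B /\ (forall ij, param_row ij = i -> B (param_col ij) (params ij om)).
Proof.
split => [h|[ok h] [|k]].
- split.
    by move=> k dk; have := h k.+1; rewrite /neuron /= weights_ge.
  move=> [[i' j]|i'] /= i'i; rewrite i'i; last by have := h 0%N.
  by have := h j.+1; rewrite /neuron /= weightsE.
- exact: (h (inr i)).
- rewrite /neuron /=; have [kd|dk] := ltnP k d.
    rewrite -[k]/(nat_of_ord (Ordinal kd)) weightsE.
    exact: (h (inl (i, Ordinal kd))).
  by rewrite weights_ge//; exact: ok.
Qed.

Lemma neuron_box_prob i B : (forall k, measurable (B k)) -> pad_ok B ->
  fine (P (neuron i @^-1` box B)) =
  \prod_(ij | param_row ij == i) fine (P (params ij @^-1` B (param_col ij))).
Proof.
move=> mB ok.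
rewrite (_ : neuron i @^-1` box B = \bigcap_ij (params ij @^-1`
    (if param_row ij == i then B (param_col ij) else setT))).
  rewrite indep; last by move=> ij; case: ifP.
  rewrite [RHS]big_mkcond; apply: eq_bigr => ij _; case: ifP => // _.
  by rewrite preimage_setT probability_setT.
apply/seteqP; split => om.
  move/neuron_boxP => [_ h] ij _ /=; case: eqP => // iji; exact: h.
move=> h; apply/neuron_boxP; split => // ij iji.
by have := h ij I; rewrite /= iji eqxx.
Qed.

(** On boxes, grouping the scalar parameters by row turns independence of the entries into
    independence of the neurons. *)
Lemma neuron_mutually_independent (A : 'I_n -> set (rseq R)) :
  (forall i, measurable (A i)) ->
  fine (P (\bigcap_i (neuron i @^-1` A i))) =
  \prod_i fine (P (neuron i @^-1` A i)).
Proof.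
apply: rseq_mutually_independent; first exact: measurable_neuron.
move=> B mB.
have [ok|] := pselect (forall i, pad_ok (B i)); last first.
  move=> /existsNP[i nok].
  have B0 : neuron i @^-1` box (B i) = set0.
    by rewrite -subset0 => om /neuron_boxP[].
  rewrite (_ : \bigcap_i _ = set0); last first.
    by rewrite -subset0 -B0 => om; exact.
  by rewrite (bigD1 i)//= B0 measure0 mul0r.
rewrite (_ : \bigcap_i _ = \bigcap_ij (params ij @^-1` B (param_row ij) (param_col ij))).
  rewrite indep//.
  rewrite (partition_big param_row predT)//=; apply: eq_bigr => i _.
  by rewrite neuron_box_prob//; apply: eq_bigr => ij /eqP ->.
apply/seteqP; split => om h.
  by move=> ij _; have /neuron_boxP[_] := h (param_row ij) I; exact.
by move=> i _; apply/neuron_boxP; split => // ij <-; exact: (h ij I).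
Qed.

Hypothesis W_normal : forall i j (B : set R), measurable B ->
  P (W i j @^-1` B) = normal_prob 0 1 B.

(** For a box [A], putting [J] in front as factor 0 gives a box for the whole neuron, whose
    probability factors by independence; uniqueness on boxes then extends the identity to all
    [A]. *)
Lemma neuron_law i (J : set R) (A : set (rseq R)) :
  measurable J -> measurable A ->
  P (b i @^-1` J `&` weights i @^-1` A) = (P (b i @^-1` J) * gauss_measure d A)%E.
Proof.
move=> mJ mA.
have mD : measurable (b i @^-1` J).
  by rewrite -[X in measurable X]setTI; exact: measurable_funP.
pose m1 : {measure set (rseq R) -> \bar R} :=
  measure_function_pushforward__canonical__measure_function_Measure (mrestr P mD)
    (measurable_weights i).
have PD0 : 0 <= fine (P (b i @^-1` J)) by exact: fine_ge0.
pose m2 : {measure set (rseq R) -> \bar R} := mscale (NngNum PD0) (gauss_measure d).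
have finP (X : set O) : measurable X -> P X \is a fin_num.
  by move=> mX; exact: fin_num_measure.
have m1E E : m1 E = P (weights i @^-1` E `&` b i @^-1` J) by [].
have m2E E : m2 E = ((fine (P (b i @^-1` J)))%:E * gauss_measure d E)%E by [].
rewrite setIC -m1E -(fineK (finP _ mD)) -m2E.
apply: rseq_measure_unique mA.
  rewrite m1E ltey_eq finP//.
  by apply: measurableI => //; rewrite preimage_setT.
move=> B mB; rewrite m1E m2E gauss_measure_box//.
pose B' k := if k is k'.+1 then B k' else J.
have mB' k : measurable (B' k) by case: k => [|k] /=.
have BE : weights i @^-1` box B `&` b i @^-1` J = neuron i @^-1` box B'.
  apply/seteqP; split => om /=.
    by move=> [h1 h2] [|k] /=; [exact: h2|exact: h1].
  by move=> h; split; [move=> k; exact: (h k.+1)|exact: (h 0%N)].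
rewrite BE.
have mN : measurable (neuron i @^-1` box B').
  rewrite -[X in measurable X]setTI; apply: measurable_neuron => //.
  exact: measurable_box.
rewrite -(fineK (finP _ mN)) -EFinM; congr (_%:E).
have [ok|nok] := pselect (pad_ok B'); last first.
  have -> : neuron i @^-1` box B' = set0 by rewrite -subset0 => om /neuron_boxP[].
  rewrite measure0 indicE memNset ?mulr0// => h; apply: nok => k dk.
  by have := h (k - d)%N; rewrite subnKC.
rewrite neuron_box_prob// indicE mem_set ?mulr1; last first.
  by move=> k; apply: (ok (d + k)%N); exact: leq_addr.
rewrite big_mkcond big_sumType /= -!big_mkcond big_pred1_eq /= mulrC; congr (_ * _).
rewrite (eq_bigl (fun p => (p.1 == i) && true)); last by move=> p; rewrite andbT.
rewrite -(pair_big (fun i' => i' == i) predT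
  (fun i' j => fine (P (W i' j @^-1` B j)))) /= big_pred1_eq.
by apply: eq_bigr => j _; rewrite W_normal.
Qed.

End neurons.

(** * Separation from serving neurons *)

Section margin.
Variable R : realType.

(** The rank is the position in a sorted enumeration. Ties are broken arbitrarily, which is
    harmless: clusters of opposite classes with equal [nu] do not activate each other's neurons. *)
Lemma exists_rank (I : finType) (nu : I -> R) :
  exists2 rk : I -> 'I_#|I|, bijective rk &
    forall i j, nu i < nu j -> (rk i < rk j)%N.
Proof.
pose leT i j := nu i <= nu j.
pose s := sort leT (enum I).
have ss : size s = #|I| by rewrite size_sort -cardE.
have us : uniq s by rewrite sort_uniq enum_uniq.
have ins i : i \in s by rewrite mem_sort mem_enum.
have lt i : (index i s < #|I|)%N by rewrite -ss index_mem.
pose rk i := Ordinal (lt i).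
have leTt : transitive leT by move=> ? ? ?; exact: le_trans.
exists rk.
  apply: inj_card_bij; last by rewrite card_ord.
  by move=> i j [] /(congr1 (nth i s)); rewrite !nth_index.
move=> i j ij; rewrite ltnNge; apply/negP => /= h.
have sorted_s : sorted leT s by apply: sort_sorted => ? ?; exact: le_total.
have /= := sorted_leq_index leTt (fun=> lexx _) sorted_s j i (ins j) (ins i) h.
by rewrite /leT leNgt ij.
Qed.

(** The difference of the two sides is half the sum of all [(y i - y j)^2]. *)
Lemma sqr_sum_le (I : finType) (y : I -> R) :
  (\sum_i y i) ^+ 2 <= #|I|%:R * \sum_i y i ^+ 2.
Proof.
have : 0 <= \sum_i \sum_j (y i - y j) ^+ 2.
  by apply: sumr_ge0 => i _; apply: sumr_ge0 => j _; exact: sqr_ge0.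
have -> : \sum_i \sum_j (y i - y j) ^+ 2 =
    #|I|%:R * (\sum_i y i ^+ 2) + #|I|%:R * (\sum_i y i ^+ 2)
    - (\sum_i y i) ^+ 2 *+ 2.
  transitivity (\sum_i (#|I|%:R * y i ^+ 2 + \sum_j y j ^+ 2 - y i * (\sum_j y j) *+ 2)).
    apply: eq_bigr => i _; rewrite mulr_natl -sumr_const mulr_sumr -sumrMnl.
    rewrite -big_split -sumrB /=; apply: eq_bigr => j _; ring.
  rewrite sumrB big_split /= -mulr_sumr sumr_const mulr_natl sumrMnl -mulr_suml.
  by rewrite expr2.
lra.
Qed.

Lemma sum_rank (I : finType) (rk : I -> 'I_#|I|) (F : nat -> R) (m : nat) :
  bijective rk -> (m <= #|I|)%N ->
  \sum_(l | (rk l < m)%N) F (rk l) = \sum_(k < m) F k.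
Proof.
move=> bij mN; rewrite (big_ord_widen _ F mN).
by rewrite [RHS](reindex rk)//; exact: onW_bij.
Qed.

(* The weights [(1 + 2 r / gamma) ^+ rank / gamma] are chosen so that, at a point
   of the cluster of rank [m], the [gamma]-activation of its own neuron outweighs
   by exactly [1] the activations [<= 2 r] of all neurons of smaller rank. *)
Lemma cluster_separation (T : Type) (I : finType) (n : nat) (eps : I -> bool)
    (nu : I -> R) (Z : I -> set T) (Phi : T -> 'cV[R]_n) (p : I -> 'I_n)
    (r gamma t : R) (Xp Xm : set T) :
  0 < r -> 0 < gamma -> 1 <= t ->
  (forall x i, 0 <= Phi x i 0) ->
  (forall l x, Z l x -> t * gamma <= Phi x (p l) 0) ->
  (forall l j x, Z j x -> eps l != eps j -> Phi x (p l) 0 <= t * (2 * r)) ->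
  (forall l j x, Z j x -> eps l != eps j -> nu j <= nu l -> Phi x (p l) 0 = 0) ->
  (forall x, Xp x -> exists2 l, eps l & Z l x) ->
  (forall x, Xm x -> exists2 l, ~~ eps l & Z l x) ->
  Xp `|` Xm !=set0 ->
  lin_sep_margin (Phi @` Xp) (Phi @` Xm) (Mfun r gamma #|I|).
Proof.
move=> r0 gam0 t1 Phi0 own bound zero Xpc Xmc X0.
have t0 : 0 < t by exact: lt_le_trans t1.
have [rk rk_bij rk_lt] := exists_rank nu.
pose rho := 1 + 2 * r / gamma.
have rg0 : 0 < 2 * r / gamma by rewrite divr_gt0// mulr_gt0.
have rho0 : 0 < rho by rewrite addr_gt0.
pose al l := rho ^+ rk l / gamma.
have al0 l : 0 < al l by rewrite divr_gt0// exprn_gt0.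
pose sg (e : bool) : R := if e then 1 else -1.
have sg2 e : sg e ^+ 2 = 1 by case: e; rewrite /sg; ring.
pose a : 'cV[R]_n := \col_i \sum_(l | p l == i) sg (eps l) * al l.
have dotE s : dotv a s = \sum_l sg (eps l) * al l * s (p l) 0.
  rewrite /dotv [RHS](partition_big p predT)//=; apply: eq_bigr => i _.
  by rewrite mxE mulr_suml; apply: eq_bigr => l /eqP ->.
have key j x : Z j x -> t <= sg (eps j) * dotv a (Phi x).
  move=> Zx; rewrite dotE mulr_sumr.
  (* This is the geometric sum, with [rho - 1 = 2 r / gamma]. *)
  have tE : t = al j * (t * gamma) - \sum_(l | (rk l < rk j)%N) al l * (t * (2 * r)).
    rewrite -mulr_suml -mulr_suml (sum_rank (fun k => rho ^+ k) rk_bij (ltnW (ltn_ord _))).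
    have := subrX1 rho (rk j); rewrite {2}/rho addrAC subrr add0r => /eqP.
    rewrite subr_eq => /eqP hE.
    rewrite /al hE; set S := \sum_(i < _) _; field.
    by rewrite gt_eqF.
  rewrite {1}tE [in leRHS](bigD1 j)//=; apply: lerD.
    rewrite [leRHS]mulrA [X in _ <= X * _]mulrA -expr2 sg2 mul1r ler_pM2l//.
    exact: own.
  rewrite big_mkcond [leRHS]big_mkcond /= -sumrN; apply: ler_sum => l _.
  have [->|lj] := eqVneq l j; first by rewrite ltnn oppr0.
  have P0 : 0 <= al l * (t * (2 * r)).
    by apply: mulr_ge0; rewrite ?ltW// !mulr_gt0.
  have N0 : - (if (rk l < rk j)%N then al l * (t * (2 * r)) else 0) <= 0.
    by case: ifP; rewrite ?oppr0 ?oppr_le0.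
  (* A neuron of the same class contributes with the right sign, as activations are nonnegative. One
     of the opposite class either vanishes or has smaller rank, and is then paid for by a subtracted
     term. *)
  have [el|el] := eqVneq (eps l) (eps j).
    apply: (le_trans N0); rewrite el [leRHS]mulrA [X in _ <= X * _]mulrA -expr2.
    by rewrite sg2 mul1r mulr_ge0// ltW.
  have sgE : sg (eps j) * sg (eps l) = -1.
    by move: el; rewrite /sg; case: (eps l); case: (eps j); rewrite ?eqxx ?mulr1 ?mul1r.
  have [jl|lj'] := leP (nu j) (nu l).
    by rewrite (zero l j)// !mulr0.
  rewrite rk_lt// [leRHS]mulrA [X in _ <= X * _]mulrA sgE mulN1r mulNr lerN2.
  by rewrite ler_pM2l//; exact: (bound l j).
have [j0 [x0 Zx0]] : exists j x, Z j x.
  by have [x [/Xpc[l _ Zl]|/Xmc[l _ Zl]]] := X0; exists l, x.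
have a0 : a != 0.
  apply/eqP => aE; have := key _ _ Zx0.
  rewrite (_ : dotv a _ = 0) ?mulr0 ?leNgt ?t0//.
  by rewrite /dotv big1// => i _; rewrite aE mxE mul0r.
pose S := \sum_l al l ^+ 2.
have S0 : 0 < S.
  rewrite /S (bigD1 j0)//= ltr_pwDl ?exprn_gt0// sumr_ge0// => l _.
  exact: sqr_ge0.
have N0 : 0 < #|I|%:R :> R by rewrite ltr0n; apply/card_gt0P; exists j0.
(* One neuron may serve several clusters, whose weights then add up in a single coordinate; the
   Cauchy-Schwarz inequality over clusters is the origin of the factor [N] in [Mfun]. *)
have nrm_le : norm2 a <= Num.sqrt (#|I|%:R * S).
  rewrite ler_sqrt; last by rewrite mulr_ge0// ltW.
  have -> : S = \sum_i \sum_l (if p l == i then sg (eps l) * al l else 0) ^+ 2.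
    rewrite exchange_big /=; apply: eq_bigr => l _.
    rewrite (bigD1 (p l))//= eqxx /= [X in _ = X + _]exprMn sg2 mul1r big1 ?addr0// => i.
    by rewrite eq_sym => /negbTE ->; rewrite expr0n.
  rewrite mulr_sumr; apply: ler_sum => i _; rewrite mxE big_mkcond.
  exact: sqr_sum_le.
have nrm_gt0 : 0 < norm2 a.
  rewrite sqrtr_gt0 lt_neqAle sumr_ge0 ?andbT => [|i _]; last exact: sqr_ge0.
  apply/eqP => /esym /psumr_eq0P h; move/eqP: a0; apply; apply/colP => i.
  rewrite [RHS]mxE; apply/eqP; rewrite -sqrf_eq0; apply/eqP; apply: h => // k _.
  exact: sqr_ge0.
(* A geometric sum of ratio [rho^2], where [rho^2 - 1 = 4 r (r + gamma) / gamma^2]. *)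
have SE : 4 * r * (r + gamma) * S = rho ^+ (2 * #|I|) - 1.
  have -> : S = (\sum_(k < #|I|) (rho ^+ 2) ^+ k) / gamma ^+ 2.
    rewrite -(sum_rank (fun k => (rho ^+ 2) ^+ k) rk_bij (leqnn _)).
    rewrite mulr_suml; apply: eq_big => [l|l _]; first by rewrite ltn_ord.
    by rewrite /al exprMn exprVn -exprM mulnC exprM.
  rewrite exprM subrX1 /rho; set s := \sum_(k < _) _; field.
  by rewrite gt_eqF.
have ME : Mfun r gamma #|I| = (Num.sqrt (#|I|%:R * S))^-1.
  rewrite /Mfun -sqrtrV; last by rewrite mulr_ge0// ltW.
  congr Num.sqrt; rewrite -[X in _ - X]mulr1 -mulrBr -SE.
  field; rewrite !gt_eqF//; exact: addr_gt0.
have sqrt0 : 0 < Num.sqrt (#|I|%:R * S) by rewrite sqrtr_gt0 mulr_gt0.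
have M_le : Mfun r gamma #|I| <= (norm2 a)^-1 by rewrite ME lef_pV2.
have pos x : Xp x -> t <= dotv a (Phi x).
  by move=> /Xpc[l el /key]; rewrite el /sg mul1r.
have neg x : Xm x -> dotv a (Phi x) <= - t.
  by move=> /Xmc[l /negbTE el /key]; rewrite el /sg mulN1r lerNr.
exists a, 0; split => //.
- by move=> _ [x Xx <-]; rewrite addr0; exact: lt_le_trans (pos x Xx).
- move=> _ [x Xx <-]; rewrite addr0; apply: le_lt_trans (neg x Xx) _.
  by rewrite oppr_lt0.
- apply: le_ereal_inf_tmp => _ [s Xs <-]; rewrite lee_fin addr0.
  have abs_ge : 1 <= `|dotv a s|.
    case: Xs => -[x Xx <-]; apply: le_trans t1 _.
      by apply: le_trans (pos x Xx) _; exact: ler_norm.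
    by rewrite -normrN; apply: le_trans (ler_norm _); rewrite lerNr; exact: neg.
  apply: (le_trans M_le); rewrite -[leLHS]mul1r ler_wpM2r// invr_ge0.
  exact: ltW.
Qed.

End margin.

(** * Probability that a neuron serves a cluster *)

Section euclid.
Variables (R : realType) (d : nat).
Implicit Types u v x y : 'cV[R]_d.

Lemma dotvC u v : dotv u v = dotv v u.
Proof. by apply: eq_bigr => i _; rewrite mulrC. Qed.

Lemma dotvBr u v x : dotv u (v - x) = dotv u v - dotv u x.
Proof. by rewrite -sumrB; apply: eq_bigr => i _; rewrite !mxE mulrBr. Qed.

Lemma dotvZr (a : R) u v : dotv u (a *: v) = a * dotv u v.
Proof. by rewrite mulr_sumr; apply: eq_bigr => i _; rewrite mxE mulrCA. Qed.

Lemma dotv_sumr (m : nat) u (w : 'I_m -> R) (p : 'I_m -> 'cV[R]_d) :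
  dotv u (\sum_i w i *: p i) = \sum_i w i * dotv u (p i).
Proof.
rewrite /dotv; under [RHS]eq_bigr do rewrite mulr_sumr.
rewrite exchange_big /=; apply: eq_bigr => j _; rewrite summxE mulr_sumr.
by apply: eq_bigr => i _; rewrite mxE mulrCA.
Qed.

Lemma norm2_ge0 u : 0 <= norm2 u. Proof. exact: sqrtr_ge0. Qed.

Lemma norm2_sqr u : norm2 u ^+ 2 = dotv u u.
Proof.
rewrite sqr_sqrtr; last by apply: sumr_ge0 => i _; exact: sqr_ge0.
by apply: eq_bigr => i _; rewrite expr2.
Qed.

Lemma norm2B_sqr u v :
  norm2 (u - v) ^+ 2 = norm2 u ^+ 2 - 2 * dotv u v + norm2 v ^+ 2.
Proof.
rewrite !norm2_sqr !dotvBr ![dotv (u - v) _]dotvC !dotvBr (dotvC v u); ring.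
Qed.

Lemma abs_coord_le u i : `|u i 0| <= norm2 u.
Proof.
rewrite -sqrtr_sqr ler_sqrt; last by apply: sumr_ge0 => j _; exact: sqr_ge0.
by rewrite (bigD1 i)//= lerDl sumr_ge0// => j _; exact: sqr_ge0.
Qed.

Lemma dotv0l u v : norm2 u = 0 -> dotv u v = 0.
Proof.
move=> u0; apply: big1 => i _.
have := abs_coord_le u i; rewrite u0 normr_le0 => /eqP ->; exact: mul0r.
Qed.

Lemma dotv_le u v : dotv u v <= norm2 u * norm2 v.
Proof.
have [u0|u0] := eqVneq (norm2 u) 0; first by rewrite dotv0l// u0 mul0r.
have [v0|v0] := eqVneq (norm2 v) 0; first by rewrite dotvC dotv0l// v0 mulr0.
have uv0 : 0 < norm2 u * norm2 v by rewrite mulr_gt0// lt_neqAle eq_sym ?u0 ?v0 norm2_ge0.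
(* With [a], [b] the two norms, this square expands to [2 a b (a b - D)], where [D] is the inner
   product. *)
have := sqr_ge0 (norm2 (norm2 v *: u - norm2 u *: v)).
rewrite norm2B_sqr !norm2_sqr !dotvZr ![dotv (_ *: _) _]dotvC !dotvZr -!norm2_sqr.
rewrite (dotvC v u); set D := dotv u v; set a := norm2 u; set b := norm2 v => h.
rewrite -(ler_pM2l uv0) -subr_ge0 -/a -/b.
rewrite -(pmulr_rge0 _ (ltr0Sn R 1)); apply: le_trans h _.
by rewrite le_eqVlt; apply/orP; left; apply/eqP; ring.
Qed.

Lemma norm2N u : norm2 (- u) = norm2 u.
Proof. by rewrite /norm2; congr Num.sqrt; apply: eq_bigr => i _; rewrite mxE sqrrN. Qed.

Lemma abs_dotv_le u v : `|dotv u v| <= norm2 u * norm2 v.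
Proof.
rewrite ler_norml dotv_le andbT lerNl.
have -> : - dotv u v = dotv u (- v) by rewrite -[- v]scaleN1r dotvZr mulN1r.
by rewrite -[norm2 v]norm2N; exact: dotv_le.
Qed.

Lemma norm2B_le u v : norm2 (u - v) <= norm2 u + norm2 v.
Proof.
rewrite -[leLHS]ger0_norm ?norm2_ge0// -[leRHS]ger0_norm ?addr_ge0 ?norm2_ge0//.
rewrite -ler_sqr ?nnegrE ?normr_ge0// !real_normK ?num_real// norm2B_sqr.
have := abs_dotv_le u v; rewrite ler_norml => /andP[h _].
by move: h; set D := dotv _ _; set a := norm2 u; set b := norm2 v; nra.
Qed.

Lemma conv_hull_dotv (X : set 'cV[R]_d) c u (a : R) :
  conv_hull X c -> (forall x, X x -> dotv u x <= a) -> dotv u c <= a.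
Proof.
move=> [m [w [p [w0 w1 Xp ->]]]] Xa; rewrite dotv_sumr.
apply: (@le_trans _ _ (\sum_i w i * a)); last by rewrite -mulr_suml w1 mul1r.
by apply: ler_sum => i _; apply: ler_wpM2l => //; exact: Xa.
Qed.

(** Testing the hull against [c] itself gives [|c|^2 <= |c| r]. For [c = 0] the claim is [0 <= r],
    which follows from a point of [X]: weights of sum 1 cannot form an empty family. *)
Lemma conv_hull_norm2 (X : set 'cV[R]_d) c (r : R) :
  conv_hull X c -> (forall x, X x -> norm2 x <= r) -> norm2 c <= r.
Proof.
move=> Xc Xr.
have h : dotv c c <= norm2 c * r.
  apply: (conv_hull_dotv Xc) => x Xx; apply: le_trans (dotv_le _ _) _.
  by apply: ler_wpM2l; [exact: norm2_ge0|exact: Xr].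
have [c0|c0] := eqVneq (norm2 c) 0.
  have [m [w [p [w0 w1 Xp _]]]] := Xc.
  case: m w p w0 w1 Xp => [|m] w p w0 w1 Xp.
    by move: w1; rewrite big_ord0 => /esym/eqP; rewrite oner_eq0.
  by rewrite c0; apply: le_trans (Xr _ (Xp ord0)); exact: norm2_ge0.
rewrite -norm2_sqr expr2 ler_pM2l// in h.
by rewrite lt_neqAle eq_sym c0 norm2_ge0.
Qed.

End euclid.

Section shifted_neuron.
Variable R : realType.
Local Open Scope ereal_scope.

(** On [K] the Cameron-Martin density is at least [exp (- M)]. *)
Lemma gauss_measure_shift n (h : nat -> R) (K : set (rseq R)) (M : R) :
  (forall i, (n <= i)%N -> h i = 0%R) -> measurable K ->
  (forall g, K g -> (\sum_(i < n) h i * g i + (\sum_(i < n) h i ^+ 2) / 2 <= M)%R) ->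
  (expR (- M))%:E * gauss_measure n K <=
  gauss_measure n [set g | K (fun i => g i - h i)%R].
Proof.
move=> h0 mK KM.
have mI : measurable_fun setT (fun g : rseq R => (\1_K g : R)%:E).
  by apply/measurable_EFinP; exact: measurable_indic.
have I0 (g : rseq R) : 0 <= (\1_K g : R)%:E by rewrite lee_fin.
rewrite /gauss_measure -gauss_expZl// ?expR_ge0//.
rewrite -[leRHS](_ : gauss_exp n (fun g => (\1_K (fun i => g i - h i)%R)%:E) = _); last first.
  by congr gauss_exp; apply/funext => g; rewrite !indicE.
rewrite (gauss_exp_shift h0 mI I0); apply: le_gauss_exp => //.
- exact: emeasurable_funM.
- apply: emeasurable_funM => //; apply/measurable_EFinP; exact: measurable_cm_density.
- move=> g; rewrite !indicE; case: (boolP (g \in K)) => [|_]; last by rewrite !mule0.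
  rewrite inE => /KM h1; rewrite !mule1 lee_fin ler_expR; lra.
Qed.

Lemma uniform_interval_prob (lam a c : R) : (0 < lam)%R -> (0 <= c)%R ->
  (- lam <= a)%R -> (a + c <= lam)%R ->
  \int[lebesgue_measure]_(x in `[a, (a + c)%R]) (uniform_pdf (- lam) lam x)%:E =
  (c / (2 * lam))%:E.
Proof.
move=> lam0 c0 la ac.
rewrite (eq_integral (fun=> ((2 * lam)^-1)%:E)) => [|x].
  rewrite integral_cst//= lebesgue_measure_itv /= lte_fin.
  have [c_eq0|c_neq0] := eqVneq c 0%R.
    by rewrite c_eq0 addr0 ltxx mule0 mul0r.
  by rewrite ltrDl lt_neqAle eq_sym c_neq0 c0 /= -EFinB -EFinM addrAC subrr add0r mulrC.
rewrite inE /= in_itv /= => /andP[h1 h2]; rewrite /uniform_pdf.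
rewrite (_ : (_ <= x <= _)%R = true); last by apply/andP; split; lra.
by congr (_^-1%:E); ring.
Qed.

End shifted_neuron.

(** * Numerical inequalities between the constants *)

Section parameters.
Variables (R : realType) (r delta w : R).
Hypotheses (r0 : 0 < r) (delta0 : 0 < delta) (delta_le : delta <= 2 * r) (w0 : 0 <= w).

Let k := 1000 * (32 * r / delta ^+ 2) ^+ 2 * (w ^+ 2 + r ^+ 2).
Let kap := Num.sqrt k.
Let L := 2 * (4 * w + r).
Let s := 36 * L / delta ^+ 2.
(** All comparisons reduce to multiples of [e^2 B]: the bound [e >= 1/4] absorbs lower powers of
    [e], and [L^2 <= 68 B] is Cauchy-Schwarz for [L = 8 w + 2 r]. *)
Let e := r ^+ 2 / delta ^+ 2.
Let B := w ^+ 2 + r ^+ 2.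

Let D0 : 0 < delta ^+ 2. Proof. exact: exprn_gt0. Qed.
Let e_ge : 1 / 4 <= e.
Proof.
rewrite /e ler_pdivlMr//.
have h : 0 <= (2 * r - delta) * (2 * r + delta).
  by apply: mulr_ge0; have := delta_le; have := delta0; have := r0; lra.
move: h; lra.
Qed.
Let L0 : 2 * r <= L. Proof. rewrite /L; move: w0; lra. Qed.
Let LB : L ^+ 2 <= 68 * B.
Proof. rewrite /L /B; have := sqr_ge0 (w - 4 * r); nra. Qed.
Let B0 : r ^+ 2 <= B. Proof. by rewrite /B lerDr sqr_ge0. Qed.
Let r2 : 0 < r ^+ 2. Proof. exact: exprn_gt0. Qed.

Let kE : k = 1000 * (1024 * (e ^+ 2 / r ^+ 2 * B)).
Proof. by rewrite /k /e /B; field; rewrite !gt_eqF. Qed.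
Let sE : s * r ^+ 2 = 36 * (L * e).
Proof. by rewrite /s /e; field; rewrite gt_eqF. Qed.

Let k0 : 0 <= k.
Proof.
apply: mulr_ge0; last exact: le_trans (ltW r2) B0.
by apply: mulr_ge0; [exact: ler0n|exact: sqr_ge0].
Qed.
Let Lp : 0 < L. Proof. have := L0; have := r0; lra. Qed.
Let ep : 0 < e. Proof. have := e_ge; lra. Qed.

Lemma scale_ge1 : 1 <= kap.
Proof.
rewrite -sqrtr1 (ler_sqrt _ k0) kE.
have h : 1 <= B / r ^+ 2 by rewrite ler_pdivlMr// mul1r.
have h2 : 1 / 16 <= e ^+ 2.
  by have := sqr_ge0 (e - 1 / 4); have := e_ge; lra.
have -> : e ^+ 2 / r ^+ 2 * B = e ^+ 2 * (B / r ^+ 2) by rewrite mulrAC mulrA.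
have : 1 / 16 * 1 <= e ^+ 2 * (B / r ^+ 2) by apply: ler_pM.
lra.
Qed.

(** Places the bias intervals [[12 L - s |c|^2, 16 L - s |c|^2]] inside the support of the bias. It
    is the most demanding estimate on the constant 1000: after squaring, [680000 e^2 B] is compared
    with [1296 * 1000 e^2 B]. *)
Lemma bias_range_bound lam : 9 * r * kap / 8 <= lam -> s * r ^+ 2 + 16 * L <= lam.
Proof.
apply: le_trans; rewrite sE.
have Le0 : 0 <= L * e by rewrite mulr_ge0// ltW.
have h : 36 * (L * e) + 16 * L <= 100 * (L * e).
  have : L * (1 / 4) <= L * e by rewrite ler_pM2l.
  lra.
apply: (le_trans h).
rewrite -ler_sqr ?nnegrE; last 2 first.
- by rewrite mulr_ge0.
- by rewrite divr_ge0// mulr_ge0 ?sqrtr_ge0// mulr_ge0// ltW.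
have -> : (9 * r * kap / 8) ^+ 2 = 81 / 64 * r ^+ 2 * kap ^+ 2 by field.
rewrite (sqr_sqrtr k0) kE.
have -> : 81 / 64 * r ^+ 2 * (1000 * (1024 * (e ^+ 2 / r ^+ 2 * B))) = 1000 * (1296 * (e ^+ 2 * B)).
  by field; rewrite gt_eqF.
have -> : (100 * (L * e)) ^+ 2 = 100 * (100 * (e ^+ 2 * L ^+ 2)) by ring.
have : e ^+ 2 * L ^+ 2 <= e ^+ 2 * (68 * B) by rewrite ler_wpM2l// sqr_ge0.
have : 0 <= e ^+ 2 * B by rewrite mulr_ge0 ?sqr_ge0// (le_trans (ltW r2)).
lra.
Qed.

(** The left side bounds minus the logarithm of the Cameron-Martin density for the shift [s c], when
    [|c| <= r] and the noise satisfies [<g, c> <= L]. *)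
Lemma shift_cost_bound : s * L + s ^+ 2 * r ^+ 2 / 2 <= k.
Proof.
have -> : s * L + s ^+ 2 * r ^+ 2 / 2 = (36 * e + 648 * e ^+ 2) * (L ^+ 2 / r ^+ 2).
  by rewrite /s /e; field; rewrite !gt_eqF.
have -> : k = 1000 * (1024 * (e ^+ 2 * (B / r ^+ 2))).
  by rewrite kE; field; rewrite gt_eqF.
have ee : 36 * e + 648 * e ^+ 2 <= 792 * e ^+ 2.
  have : e * (1 / 4) <= e * e by rewrite ler_pM2l.
  rewrite expr2; lra.
have e2 := sqr_ge0 e.
have LBr : L ^+ 2 / r ^+ 2 <= 68 * (B / r ^+ 2).
  by rewrite mulrA ler_wpM2r// invr_ge0 ltW.
have Lr0 : 0 <= L ^+ 2 / r ^+ 2 by rewrite divr_ge0 ?sqr_ge0.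
apply: (@le_trans _ _ (792 * e ^+ 2 * (L ^+ 2 / r ^+ 2))).
  by rewrite ler_wpM2r.
apply: (@le_trans _ _ (792 * e ^+ 2 * (68 * (B / r ^+ 2)))).
  by apply: ler_wpM2l; [apply: mulr_ge0; [exact: ler0n|exact: e2]|exact: LBr].
have : 0 <= e ^+ 2 * (B / r ^+ 2).
  by rewrite mulr_ge0// divr_ge0 ?sqr_ge0// (le_trans (ltW r2)).
rewrite -!mulrA; lra.
Qed.

(** A serving neuron is at least [10 L] on its own cluster and at most [s r^2 + 17 L] on the data.
    The two inequalities let one scale [t >= 1] turn these levels into [t gamma] and [2 r t]. *)
Lemma margin_bounds gamma : 0 <= gamma -> gamma <= delta ^+ 2 / (18 * r * kap) ->
  gamma <= 10 * L /\ gamma * (s * r ^+ 2 + 17 * L) <= 2 * r * (10 * L).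
Proof.
move=> g0 gle.
have kap1 := scale_ge1.
have gle' : gamma <= delta ^+ 2 / (18 * r).
  have r18 : 0 < 18 * r by rewrite mulr_gt0.
  apply: (le_trans gle); rewrite ler_pM2l// lef_pV2 ?posrE//.
    by rewrite ler_peMr// ltW.
  by rewrite mulr_gt0// (lt_le_trans _ kap1).
have De : delta ^+ 2 * e = r ^+ 2 by rewrite /e mulrC divfK ?gt_eqF.
have D4 : delta ^+ 2 <= 4 * r ^+ 2.
  have : delta ^+ 2 * (1 / 4) <= delta ^+ 2 * e by rewrite ler_pM2l.
  rewrite De; lra.
have gr : gamma <= r.
  apply: (le_trans gle'); rewrite ler_pdivrMr ?mulr_gt0//.
  have -> : r * (18 * r) = 18 * r ^+ 2 by ring.
  by move: D4 r2; lra.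
split; first by have := L0; have := r0; lra.
rewrite sE.
have -> : 36 * (L * e) + 17 * L = L * (36 * e + 17) by ring.
rewrite mulrCA.
have -> : 2 * r * (10 * L) = L * (20 * r) by ring.
rewrite ler_pM2l//.
apply: (@le_trans _ _ (delta ^+ 2 / (18 * r) * (36 * e + 17))).
  by rewrite ler_wpM2r// addr_ge0// mulr_ge0// ltW.
rewrite mulrAC ler_pdivrMr ?mulr_gt0//.
have -> : delta ^+ 2 * (36 * e + 17) = 36 * (delta ^+ 2 * e) + 17 * delta ^+ 2 by ring.
rewrite De (_ : 20 * r * _ = 20 * (18 * r ^+ 2)); last by ring.
by move: D4 r2; lra.
Qed.

End parameters.

(** * Union bound over the clusters *)

Section covering.
Context (dO : measure_display) (O : measurableType dO) (R : realType)
  (P : probability O R).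

Lemma measure_bigsetU_le (I : Type) (s : seq I) (G : I -> set O) :
  (forall l, measurable (G l)) ->
  (P (\big[setU/set0]_(l <- s) G l) <= \sum_(l <- s) P (G l))%E.
Proof.
move=> mG; elim: s => [|l s IH]; first by rewrite !big_nil measure0.
rewrite !big_cons; apply: (@le_trans _ _ (P (G l) + P (\big[setU/set0]_(j <- s) G j))%E).
  by apply: measureU2 => //; exact: bigsetU_measurable.
exact: leeD.
Qed.

(** All neurons fail a given cluster with probability at most [(1 - q)^n <= exp (- q n) <= eta / N];
    the [N] failures are summed. *)
Lemma covering_probability (n d : nat) (W : 'I_n -> 'I_d -> {RV P >-> R})
    (b : 'I_n -> {RV P >-> R}) (I : finType) (A : I -> set (rseq R)) (q eta : R) :
  mutually_independent (params W b) -> (forall l, measurable (A l)) ->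
  (forall l i, q <= fine (P (neuron W b i @^-1` A l))) ->
  (0 < #|I|)%N -> 0 < eta -> ln (#|I|%:R / eta) <= q * n%:R ->
  measurable (\bigcap_l \bigcup_i (neuron W b i @^-1` A l)) /\
  ((1 - eta)%:E <= P (\bigcap_l \bigcup_i (neuron W b i @^-1` A l)))%E.
Proof.
move=> indep mA qP I0 eta0 nq.
have mN l i : measurable (neuron W b i @^-1` A l).
  by rewrite -[X in measurable X]setTI; exact: measurable_neuron.
set F := \bigcap_l _.
have mF : measurable F.
  apply: fin_bigcap_measurable; first exact: finite_finset.
  by move=> l _; apply: fin_bigcup_measurable; first exact: finite_finset.
split => //.
pose G l := \bigcap_i (neuron W b i @^-1` ~` A l).
have mG l : measurable (G l).
  apply: fin_bigcap_measurable; first exact: finite_finset.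
  by move=> i _; rewrite preimage_setC; apply: measurableC; exact: mN.
have FC : ~` F = \big[setU/set0]_(l <- index_enum I) G l.
  rewrite -bigcup_seq setC_bigcap; apply/seteqP; split => om [l _].
    by rewrite setC_bigcup => h; exists l => //=; rewrite mem_index_enum.
  by move=> h; exists l => //; rewrite setC_bigcup.
have finP (Z : set O) : measurable Z -> P Z \is a fin_num.
  by move=> mZ; exact: fin_num_measure.
have PG l : (P (G l) <= (eta / #|I|%:R)%:E)%E.
  rewrite -(fineK (finP _ (mG l))) lee_fin neuron_mutually_independent//; last first.
    by move=> i; exact: measurableC.
  have N0 : 0 < #|I|%:R :> R by rewrite ltr0n.
  apply: (@le_trans _ _ (\prod_(i < n) expR (- q))).
    apply: ler_prod => i _; apply/andP; split; first exact: fine_ge0.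
    rewrite preimage_setC probability_setC; last exact: mN.
    rewrite fineB ?finP//=; last exact: mN.
    by apply: le_trans (expR_ge1Dx _); rewrite lerD2l lerN2; exact: qP.
  rewrite prodr_const card_ord -expRM_natl -(@lnK _ (eta / #|I|%:R)) ?posrE ?divr_gt0//.
  rewrite ler_expR -[X in ln X]invrK lnV ?posrE ?invr_gt0 ?divr_gt0// invf_div.
  by rewrite mulrN lerN2 (mulrC n%:R).
have PFC : (P (~` F) <= eta%:E)%E.
  rewrite FC; apply: le_trans (measure_bigsetU_le _ mG) _.
  apply: (@le_trans _ _ (\sum_(l <- index_enum I) (eta / #|I|%:R)%:E)%E).
    by apply: lee_sum => l _.
  rewrite sumEFin lee_fin sumr_const -[X in _ *+ X]/#|I| -[_ *+ _]mulr_natr divfK// pnatr_eq0.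
  by rewrite -lt0n.
rewrite -[F]setCK probability_setC; last exact: measurableC.
rewrite -(fineK (finP _ (measurableC mF))) -EFinB lee_fin lerD2l lerN2 -lee_fin.
by rewrite fineK ?finP//; exact: measurableC.
Qed.

(** It suffices that [exp (-1) >= 1/4], which is the square of [exp (-1/2) >= 1 - 1/2]. *)
Lemma powR_le_expRN (beta k : R) : 0 < beta -> beta <= 4^-1 -> 0 <= k ->
  beta `^ k <= expR (- k).
Proof.
move=> b0 b4 k0; rewrite /powR gt_eqF// ler_expR.
suff : ln beta <= - 1 by move=> h; rewrite -[leRHS]mulrN1 ler_wpM2l.
rewrite -[leRHS]expRK ler_ln ?posrE ?expR_gt0//; apply: (le_trans b4).
have -> : - 1 = - 2^-1 + - 2^-1 :> R by lra.
rewrite expRD; have := expR_ge1Dx (- 2^-1 : R); set x := expR _ => h.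
have h2 : 2^-1 <= x by move: h; lra.
by have -> : 4^-1 = 2^-1 * 2^-1 :> R; [lra|apply: ler_pM].
Qed.

End covering.

(* Each [y] in [Xm] is a difference [x0 - (x0 - y)] of elements of the set, so the
   oscillation bounds the size of the form, not only its variation. *)
Lemma linear_form_bound (R : realType) (d : nat) (Xp Xm : set 'cV[R]_d) (g : nat -> R)
    (L : R) :
  Xp !=set0 -> Xm !=set0 ->
  (forall y z, (mdiff Xp Xm `|` Xp `|` Xm) y -> (mdiff Xp Xm `|` Xp `|` Xm) z ->
     \sum_(i < d) g i * y i 0 - \sum_(i < d) g i * z i 0 <= L) ->
  forall x, (Xp `|` Xm) x -> `|\sum_(i < d) g i * x i 0| <= 2 * L.
Proof.
move=> [x0 Xx0] [y0 Xy0] TL.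
pose ell (x : 'cV[R]_d) := \sum_(i < d) g i * x i 0.
have ellB x y : ell (x - y) = ell x - ell y.
  by rewrite /ell -sumrB; apply: eq_bigr => i _; rewrite !mxE mulrBr.
have Ty y : Xm y -> `|ell y| <= L.
  move=> Xy.
  have Tx : (mdiff Xp Xm `|` Xp `|` Xm) x0 by left; right.
  have Txy : (mdiff Xp Xm `|` Xp `|` Xm) (x0 - y) by left; left; exists x0, y.
  have := TL _ _ Tx Txy; have := TL _ _ Txy Tx; rewrite -/(ell _) -/(ell _) ellB.
  by rewrite ler_norml; lra.
move=> x [Xx|Xx]; rewrite -/(ell x); last first.
  by have h := Ty x Xx; have := normr_ge0 (ell x); lra.
have Tx : (mdiff Xp Xm `|` Xp `|` Xm) x by left; right.
have Ty0 : (mdiff Xp Xm `|` Xp `|` Xm) y0 by right.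
have := TL _ _ Tx Ty0; have := TL _ _ Ty0 Tx; rewrite -/(ell _) -/(ell _).
by have := Ty _ Xy0; rewrite !ler_norml; lra.
Qed.

(** * Separation of two classes covered by small clusters *)

Section core.
Context (R : realType) (r delta : R) (d n : nat) (Xp Xm : set 'cV[R]_d).
Hypotheses (r0 : 0 < r) (delta0 : 0 < delta) (delta_le : delta <= 2 * r).
Hypotheses (Xpr : Xp `<=` ball2 0 r) (Xmr : Xm `<=` ball2 0 r).
Hypotheses (Xp0 : Xp !=set0) (Xm0 : Xm !=set0).

Let T := mdiff Xp Xm `|` Xp `|` Xm.
Let w := gaussian_width T.
Let k := 1000 * (32 * r / delta ^+ 2) ^+ 2 * (w ^+ 2 + r ^+ 2).
Let kap := Num.sqrt k.
Let L := 2 * (4 * w + r).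
(** The factor 36 makes displacement within a cluster cost at most [L], while the gap [delta^2 / 2]
    between centres is worth [18 L]. *)
Let s := 36 * L / delta ^+ 2.

Let Xnorm x : (Xp `|` Xm) x -> norm2 x <= r.
Proof. by move=> [/Xpr|/Xmr]; rewrite /ball2 /= subr0. Qed.

Let T_coord y i : T y -> `|y i 0| <= r + r.
Proof.
move=> Ty; apply: le_trans (abs_coord_le _ _) _.
case: Ty => [[[x [z [Xx [Xz ->]]]]|Xy]|Xy].
- apply: le_trans (norm2B_le _ _) _; apply: lerD; apply: Xnorm; by [left|right].
- by apply: (@le_trans _ _ r); [apply: Xnorm; left|rewrite lerDl ltW].
- by apply: (@le_trans _ _ r); [apply: Xnorm; right|rewrite lerDl ltW].
Qed.

Let concentration : 0 <= w /\
  exists2 K : set (rseq R), measurable K &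
    ((2^-1)%:E <= gauss_measure d K)%E /\
    forall g x, K g -> (Xp `|` Xm) x -> `|\sum_(i < d) g i * x i 0| <= L.
Proof.
have [x0 Xx0] := Xp0.
have Tx0 : T x0 by left; right.
have rr0 : 0 <= r + r by rewrite addr_ge0// ltW.
have [w0 [K mK [K2 KT]]] := gaussian_width_concentration Tx0 rr0 T_coord r0.
split => //; exists K => //; split => // g x Kg Xx.
apply: (@linear_form_bound _ _ Xp Xm) => // y z Ty Tz; exact: KT.
Qed.

Let w0 : 0 <= w. Proof. by case: concentration. Qed.
Let kap1 : 1 <= kap. Proof. exact: scale_ge1. Qed.
Let Lr : 2 * r <= L. Proof. rewrite /L; move: w0; lra. Qed.
Let L0 : 0 < L. Proof. by move: Lr r0; lra. Qed.
Let s0 : 0 < s. Proof. by apply: divr_gt0; [exact: mulr_gt0|exact: exprn_gt0]. Qed.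
Let sD : s * delta ^+ 2 = 36 * L.
Proof. by rewrite /s divfK//; apply: lt0r_neq0; exact: exprn_gt0. Qed.

Section activation.
Variables (c x : 'cV[R]_d) (beta a rho : R).
Hypotheses (cr : norm2 c <= r) (xr : norm2 x <= r) (aL : `|a| <= L)
  (rho_le : rho <= delta ^+ 2 / (36 * r * kap))
  (beta_ge : 12 * L - s * norm2 c ^+ 2 <= beta)
  (beta_le : beta <= 16 * L - s * norm2 c ^+ 2).

Let srho (c' : 'cV[R]_d) : norm2 (x - c') <= rho -> s * `|dotv c (x - c')| <= L.
Proof.
move=> xc'.
have rr : r * rho <= delta ^+ 2 / 36.
  have -> : delta ^+ 2 / 36 = r * (delta ^+ 2 / (36 * r)) by field; rewrite gt_eqF.
  rewrite ler_pM2l//; apply: (le_trans rho_le).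
  have r36 : 0 < 36 * r by rewrite mulr_gt0.
  rewrite ler_pM2l ?exprn_gt0// lef_pV2 ?posrE//; first by rewrite ler_peMr// ltW.
  by rewrite mulr_gt0// (lt_le_trans _ kap1).
apply: (@le_trans _ _ (s * (delta ^+ 2 / 36))).
  rewrite ler_pM2l//; apply: le_trans rr; apply: le_trans (abs_dotv_le _ _) _.
  by apply: ler_pM => //; exact: norm2_ge0.
by rewrite mulrA sD mulrC mulrA mulVf ?mul1r// pnatr_eq0.
Qed.

(** The term [s |c|^2] cancels against the bias; of the remaining [12 L], the noise takes [L] and
    the radius another [L]. *)
Lemma activation_own : norm2 (x - c) <= rho -> 10 * L <= a + s * dotv c x + beta.
Proof.
move=> xc; have := srho xc; rewrite dotvBr -norm2_sqr => h.
have h2 : - L <= s * (dotv c x - norm2 c ^+ 2).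
  rewrite lerNl -mulrN; apply: le_trans h; rewrite ler_pM2l//.
  by rewrite -normrN; exact: ler_norm.
have /ler_normlP[a1 a2] := aL.
by move: h2 beta_ge a1 a2; rewrite mulrBr; lra.
Qed.

(** The bias leaves at most [16 L], noise and radius add [L] each, and the gap between the centres
    removes [18 L]. *)
Lemma activation_opposite (c' : 'cV[R]_d) : norm2 (x - c') <= rho ->
  delta <= norm2 (c - c') -> norm2 c' <= norm2 c ->
  a + s * dotv c x + beta <= 0.
Proof.
move=> xc' cc' c'c; have := srho xc'; rewrite dotvBr => h.
have h2 : s * (dotv c x - dotv c c') <= L.
  by apply: le_trans h; rewrite ler_pM2l//; exact: ler_norm.
have h3 : s * dotv c c' <= s * norm2 c ^+ 2 - 18 * L.
  have -> : 18 * L = s * (delta ^+ 2 / 2).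
    by rewrite mulrA sD; lra.
  rewrite -mulrBr ler_pM2l//.
  have d2 : delta ^+ 2 <= norm2 (c - c') ^+ 2.
    by rewrite ler_sqr ?nnegrE ?norm2_ge0// ltW.
  have n2 : norm2 c' ^+ 2 <= norm2 c ^+ 2 by rewrite ler_sqr ?nnegrE ?norm2_ge0.
  by move: d2 n2; rewrite norm2B_sqr; lra.
have /ler_normlP[a1 a2] := aL.
by move: h2 h3 beta_le a1 a2; rewrite mulrBr; lra.
Qed.

Lemma activation_le : a + s * dotv c x + beta <= s * r ^+ 2 + 17 * L.
Proof.
have h : s * dotv c x <= s * r ^+ 2.
  rewrite ler_pM2l//; apply: le_trans (dotv_le _ _) _; rewrite expr2.
  by apply: ler_pM => //; exact: norm2_ge0.
have h2 : 0 <= s * norm2 c ^+ 2 by rewrite mulr_ge0 ?sqr_ge0// ltW.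
have /ler_normlP[a1 a2] := aL.
by move: h h2 beta_le a1 a2; lra.
Qed.

End activation.

Lemma clusters_separable (I : finType) (eps : I -> bool) (ctr : I -> 'cV[R]_d)
    (rad : I -> R) (gamma lam eta : R) (dO : measure_display)
    (O : measurableType dO) (P : probability O R)
    (W : 'I_n -> 'I_d -> {RV P >-> R}) (b : 'I_n -> {RV P >-> R}) :
  (forall l, conv_hull (if eps l then Xp else Xm) (ctr l)) ->
  (forall l, rad l <= delta ^+ 2 / (36 * r * kap)) ->
  (forall l j, eps l != eps j -> delta <= norm2 (ctr l - ctr j)) ->
  (forall x, Xp x -> exists2 l, eps l & ball2 (ctr l) (rad l) x) ->
  (forall x, Xm x -> exists2 l, ~~ eps l & ball2 (ctr l) (rad l) x) ->
  0 < gamma -> gamma <= delta ^+ 2 / (18 * r * kap) ->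
  9 * r * kap / 8 <= lam -> 0 < eta ->
  ln (#|I|%:R / eta) /
    (r / (4 * lam * kap) * (2 * delta ^+ 2 / (81 * r ^+ 2)) `^ k) <= n%:R ->
  (forall i j (B : set R), measurable B ->
      P (W i j @^-1` B) = normal_prob 0 1 B) ->
  (forall i (B : set R), measurable B ->
      P (b i @^-1` B) =
        (\int[lebesgue_measure]_(x in B) (uniform_pdf (- lam) lam x)%:E)%E) ->
  mutually_independent (params W b) ->
  let Phi := fun (om : O) (x : 'cV[R]_d) =>
    relu ((\matrix_(i < n, j < d) W i j om) *m x + \col_(i < n) b i om) in
  exists F : set O,
    [/\ measurable F,
        F `<=` [set om | lin_sep_margin (Phi om @` Xp) (Phi om @` Xm)
                                        (Mfun r gamma #|I|)]
      & ((1 - eta)%:E <= P F)%E].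
Proof.
move=> ctr_conv rad_le ctr_sep Xp_cov Xm_cov gamma0 gamma_le lam_ge eta0 n_ge
  W_normal b_unif indep Phi.
have [_ [K mK [K2 KL]]] := concentration.
have sub_X l x : (if eps l then Xp else Xm) x -> (Xp `|` Xm) x.
  by case: ifP => _ ?; [left|right].
have ctr_r l : norm2 (ctr l) <= r.
  by apply: (conv_hull_norm2 (ctr_conv l)) => x /sub_X; exact: Xnorm.
have kap0 : 0 < kap := lt_le_trans ltr01 kap1.
have lam0 : 0 < lam by apply: lt_le_trans lam_ge; rewrite divr_gt0// !mulr_gt0.
have lam_bound : s * r ^+ 2 + 16 * L <= lam by exact: bias_range_bound.
have k0 : 0 <= k.
  apply: mulr_ge0; last by rewrite addr_ge0// sqr_ge0.
  by apply: mulr_ge0; [exact: ler0n|exact: sqr_ge0].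
pose h l (i : nat) := if insub i is Some j then s * ctr l j 0 else 0.
have hE l (j : 'I_d) : h l j = s * ctr l j 0 by rewrite /h valK.
pose al l := 12 * L - s * norm2 (ctr l) ^+ 2.
pose A l : set (rseq R) :=
  [set y | `[al l, al l + 4 * L]%classic (y 0%N) /\ K (fun i => y i.+1 - h l i)].
pose KS l : set (rseq R) := [set g | K (fun i => g i - h l i)].
have mKS l : measurable (KS l).
  have mf : measurable_fun setT (fun g : rseq R => (fun i => g i - h l i) : rseq R).
    apply: measurable_to_rseq => i; apply: measurable_funB => //.
    exact: measurable_coord.
  by have := mf measurableT K mK; rewrite setTI.
have mA l : measurable (A l).
  apply: (@measurableI _ (rseq R) [set y | `[al l, al l + 4 * L]%classic (y 0%N)]
    [set y | KS l (fun i => y i.+1)]).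
    have := @measurable_coord R 0%N measurableT `[al l, al l + 4 * L]%classic.
    by rewrite setTI; apply; exact: measurable_itv.
  have mf : measurable_fun setT (fun y : rseq R => (fun i => y i.+1) : rseq R).
    by apply: measurable_to_rseq => i; exact: measurable_coord.
  by have := mf measurableT _ (mKS l); rewrite setTI.
(* Centres need not be data points; the bound passes to convex hulls by linearity. *)
have Kctr l g : K g -> \sum_(i < d) ctr l i 0 * g i <= L.
  move=> Kg; pose u : 'cV[R]_d := \col_i g i.
  have uE x : dotv u x = \sum_(i < d) g i * x i 0.
    by apply: eq_bigr => i _; rewrite mxE.
  have -> : \sum_(i < d) ctr l i 0 * g i = dotv u (ctr l).
    by rewrite uE; apply: eq_bigr => i _; rewrite mulrC.
  apply: (conv_hull_dotv (ctr_conv l)) => x /sub_X Xx; rewrite uE.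
  by apply: le_trans (ler_norm _) _; exact: KL.
pose M := s * L + s ^+ 2 * r ^+ 2 / 2.
have gKS l : ((expR (- M) / 2)%:E <= gauss_measure d (KS l))%E.
  have hM g : K g -> \sum_(i < d) h l i * g i + (\sum_(i < d) h l i ^+ 2) / 2 <= M.
    move=> Kg; apply: lerD.
      rewrite (eq_bigr (fun i : 'I_d => s * (ctr l i 0 * g i))); last first.
        by move=> i _; rewrite hE mulrA.
      by rewrite -mulr_sumr ler_pM2l//; exact: Kctr.
    rewrite ler_wpM2r// (eq_bigr (fun i : 'I_d => s ^+ 2 * (ctr l i 0 * ctr l i 0))); last first.
      by move=> i _; rewrite hE exprMn [ctr l i 0 ^+ 2]expr2.
    rewrite -mulr_sumr ler_wpM2l ?sqr_ge0// -/(dotv _ _) -norm2_sqr.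
    by rewrite ler_sqr ?nnegrE ?norm2_ge0// ltW.
  have h0 i : (d <= i)%N -> h l i = 0 by move=> di; rewrite /h insubN// -leqNgt.
  apply: le_trans (gauss_measure_shift h0 mK hM).
  rewrite EFinM; apply: lee_wpmul2l; last exact: K2.
  by rewrite lee_fin; exact: expR_ge0.
pose q := r / (4 * lam * kap) * (2 * delta ^+ 2 / (81 * r ^+ 2)) `^ k.
have beta0 : 0 < 2 * delta ^+ 2 / (81 * r ^+ 2).
  by rewrite divr_gt0// mulr_gt0// exprn_gt0.
have q0 : 0 < q by rewrite mulr_gt0 ?powR_gt0// divr_gt0// !mulr_gt0.
(* The bias hits an interval of length [4 L] out of [2 lam], and the shifted noise set has measure
   at least [exp (- M) / 2]. *)
have q_le : q <= 4 * L / (2 * lam) * (expR (- M) / 2).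
  have -> : 4 * L / (2 * lam) * (expR (- M) / 2) = L / lam * expR (- M).
    by field; rewrite gt_eqF.
  apply: ler_pM; rewrite ?powR_ge0//.
  - by rewrite divr_ge0 ?mulr_ge0// ltW.
  - rewrite ler_pdivrMr ?mulr_gt0//.
    have -> : L / lam * (4 * lam * kap) = 4 * (L * kap) by field; rewrite gt_eqF.
    have : L * 1 <= L * kap by rewrite ler_pM2l.
    by move: Lr r0; lra.
  - apply: (@le_trans _ _ (expR (- k))).
      apply: powR_le_expRN => //; rewrite ler_pdivrMr ?mulr_gt0 ?exprn_gt0//.
      have d4 : delta ^+ 2 <= (2 * r) ^+ 2 by rewrite ler_sqr ?nnegrE// ?mulr_ge0// ltW.
      have r2 : 0 <= r ^+ 2 by exact: sqr_ge0.
      by move: d4 r2; rewrite exprMn; lra.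
    by rewrite ler_expR lerN2; exact: shift_cost_bound.
have finP (Z : set O) : measurable Z -> P Z \is a fin_num.
  by move=> mZ; exact: fin_num_measure.
have qP l i : q <= fine (P (neuron W b i @^-1` A l)).
  have mN : measurable (neuron W b i @^-1` A l).
    by rewrite -[X in measurable X]setTI; exact: measurable_neuron.
  rewrite -lee_fin (fineK (finP _ mN)).
  have -> : neuron W b i @^-1` A l =
    b i @^-1` `[al l, al l + 4 * L] `&` weights W i @^-1` KS l by [].
  have mJ : measurable (`[al l, al l + 4 * L]%classic : set R) by exact: measurable_itv.
  rewrite (neuron_law indep W_normal i mJ (mKS l)) (b_unif i _ mJ).
  have c2 : 0 <= s * norm2 (ctr l) ^+ 2 by rewrite mulr_ge0 ?sqr_ge0// ltW.
  have c2r : s * norm2 (ctr l) ^+ 2 <= s * r ^+ 2.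
    by rewrite ler_pM2l// ler_sqr ?nnegrE ?norm2_ge0// ltW.
  rewrite uniform_interval_prob//; last 3 first.
  - by rewrite mulr_ge0// ltW.
  - by move: c2 c2r lam_bound L0; rewrite /al; lra.
  - have sr2 : 0 <= s * r ^+ 2 by rewrite mulr_ge0 ?sqr_ge0// ltW.
    by move: c2 sr2 lam_bound; rewrite /al; lra.
  apply: (@le_trans _ _ ((4 * L / (2 * lam))%:E * (expR (- M) / 2)%:E)%E).
    by rewrite -EFinM lee_fin.
  apply: lee_wpmul2l => //; rewrite lee_fin divr_ge0// mulr_ge0// ltW//.
have I0 : (0 < #|I|)%N.
  by have [x /Xp_cov[l _ _]] := Xp0; apply/card_gt0P; exists l.
have nq : ln (#|I|%:R / eta) <= q * n%:R by rewrite (mulrC q) -ler_pdivrMr.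
have [mF PF] := covering_probability indep mA qP I0 eta0 nq.
exists (\bigcap_l \bigcup_i (neuron W b i @^-1` A l)); split => //.
move=> om omF.
have /choice[p pA] : forall l, exists i, A l (neuron W b i om).
  by move=> l; have [i _ h1] := omF l Logic.I; exists i.
pose Z l := (if eps l then Xp else Xm) `&` ball2 (ctr l) (rad l).
pose act i (x : 'cV[R]_d) := \sum_(j < d) W i j om * x j 0 + b i om.
have PhiE x i : Phi om x i 0 = Num.max (act i x) 0.
  rewrite !mxE /act; congr (Num.max (_ + _) 0).
  by apply: eq_bigr => j _; rewrite mxE.
pose a l (x : 'cV[R]_d) := \sum_(j < d) (weights W (p l) om j - h l j) * x j 0.
have actE l x : act (p l) x = a l x + s * dotv (ctr l) x + b (p l) om.
  rewrite /act /a /dotv mulr_sumr -big_split /=; congr (_ + _).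
  by apply: eq_bigr => j _; rewrite weightsE hE; ring.
have aL l x : (Xp `|` Xm) x -> `|a l x| <= L.
  by move=> Xx; have [_ Kl] := pA l; exact: (KL _ x Kl).
have bJ l : 12 * L - s * norm2 (ctr l) ^+ 2 <= b (p l) om <=
    16 * L - s * norm2 (ctr l) ^+ 2.
  have [+ _] := pA l; rewrite /= in_itv /= => /andP[h1 h2].
  by rewrite h1 /=; move: h2; rewrite /al /neuron /=; lra.
have [g10 g17] := margin_bounds r0 delta0 delta_le w0 (ltW gamma0) gamma_le.
(* The least scale [t >= 1] for which [2 r t] dominates all activations; [margin_bounds] keeps
   [t gamma] below [10 L]. *)
pose t := Num.max 1 ((s * r ^+ 2 + 17 * L) / (2 * r)).
have r20 : 0 < 2 * r by rewrite mulr_gt0.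
have tg : t * gamma <= 10 * L.
  rewrite -ler_pdivlMr// /t ge_max; apply/andP; split; rewrite ler_pdivlMr//.
    by rewrite mul1r.
  by rewrite mulrAC ler_pdivrMr// mulrC [leRHS]mulrC.
have tr : s * r ^+ 2 + 17 * L <= t * (2 * r).
  by rewrite -ler_pdivrMr// /t le_max lexx orbT.
have ZX l x : Z l x -> (Xp `|` Xm) x by move=> [/sub_X].
apply: (@cluster_separation R _ I n eps (fun l => norm2 (ctr l)) Z (Phi om) p r gamma t) => //.
- by rewrite le_max lexx.
- by move=> x i; rewrite PhiE le_max lexx orbT.
- move=> l x Zx; rewrite PhiE le_max; apply/orP; left; apply: (le_trans tg).
  have /andP[b1 _] := bJ l; rewrite actE.
  apply: activation_own (ctr_r l) (aL l x (ZX _ _ Zx)) (rad_le l) b1 _.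
  by case: Zx.
- move=> l j x Zx _; rewrite PhiE ge_max; apply/andP; split; last first.
    by rewrite mulr_ge0// ?(ltW r20)// /t le_max ler01.
  apply: le_trans tr; have /andP[_ b2] := bJ l; rewrite actE.
  exact: activation_le (ctr_r l) (Xnorm (ZX _ _ Zx)) (aL l x (ZX _ _ Zx)) b2.
- move=> l j x Zx lj jl; rewrite PhiE; apply/max_idPr.
  have /andP[_ b2] := bJ l; rewrite actE.
  apply: (activation_opposite (ctr_r l) (aL l x (ZX _ _ Zx)) (rad_le j) b2 _ (ctr_sep l j lj) jl).
  by case: Zx.
- by move=> x Xx; have [l el bl] := Xp_cov x Xx; exists l => //; split => //; rewrite el.
- move=> x Xx; have [l el bl] := Xm_cov x Xx; exists l => //; split => //.
  by rewrite (negbTE el).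
- by have [x Xx] := Xp0; exists x; left.
Qed.

End core.

(** * An empty class, and the reduction of the theorem to clusters *)

(** An offset of size [|M| + 1] suffices, since coordinate 0 of the output is nonnegative. This case
    stands apart because distances to an empty set of centres are infinite, so the radii are
    unconstrained, and [delta <= 2 R] cannot be inferred. *)
Lemma one_class_separation (R : realType) (T : Type) (n : nat) (Phi : T -> 'cV[R]_n)
    (Xp Xm : set T) (M : R) :
  (0 < n)%N -> (forall x i, 0 <= Phi x i 0) -> Xp = set0 \/ Xm = set0 ->
  lin_sep_margin (Phi @` Xp) (Phi @` Xm) M.
Proof.
case: n Phi => [//|n] Phi _ Phi0.
have M0 : 0 < `|M| + 1 by rewrite ltr_pwDr.
pose u : 'cV[R]_n.+1 := delta_mx ord0 0.
have ne (e : R) : e ^+ 2 = 1 -> norm2 (e *: u) = 1.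
  move=> e2; rewrite /norm2 (bigD1 ord0)//= big1 => [|i i0].
    by rewrite !mxE !eqxx mulr1 addr0 e2 sqrtr1.
  by rewrite !mxE (negbTE i0) mulr0 expr0n.
have ne0 (e : R) : e ^+ 2 = 1 -> e *: u != 0.
  move=> e2; apply/eqP => e0; have := ne e e2.
  rewrite e0 /norm2 big1 ?sqrtr0 => [/eqP|i _]; last by rewrite mxE expr0n.
  by rewrite eq_sym oner_eq0.
have du (e : R) s : dotv (e *: u) s = e * s ord0 0.
  rewrite /dotv (bigD1 ord0)//= big1 ?addr0 => [|i i0].
    by rewrite !mxE !eqxx mulr1.
  by rewrite !mxE (negbTE i0) mulr0 mul0r.
have gap (x : R) : 0 <= x -> M <= `|x + (`|M| + 1)|.
  move=> x0; apply: le_trans (ler_norm _).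
  by apply: le_trans (ler_norm M) _; rewrite addrCA lerDl addr_ge0.
case=> [->|->].
- exists (- 1 *: u), (- (`|M| + 1)); split.
  + by apply: ne0; rewrite sqrrN expr1n.
  + by move=> s [x []].
  + move=> _ [x _ <-]; rewrite du mulN1r -opprD oppr_lt0.
    by rewrite ltr_wpDl.
  + apply: le_ereal_inf_tmp => _ [_ [[x []]|[x _ <-]] <-].
    rewrite lee_fin ne ?sqrrN ?expr1n// divr1 du mulN1r -opprD normrN.
    exact: gap.
- exists (1 *: u), (`|M| + 1); split.
  + by apply: ne0; rewrite expr1n.
  + by move=> _ [x _ <-]; rewrite du mul1r ltr_wpDl.
  + by move=> s [x []].
  + apply: le_ereal_inf_tmp => _ [_ [[x _ <-]|[x []]] <-].
    by rewrite lee_fin ne ?expr1n// divr1 du mul1r; exact: gap.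
Qed.

Lemma conv_hullS (R : realType) (d : nat) (X Y : set 'cV[R]_d) :
  X `<=` Y -> conv_hull X `<=` conv_hull Y.
Proof.
move=> XY x [m [w [p [w0 w1 Xp ->]]]]; exists m, w, p; split => // i.
exact: XY.
Qed.

Lemma sub_conv_hull (R : realType) (d : nat) (X : set 'cV[R]_d) : X `<=` conv_hull X.
Proof.
move=> x Xx; exists 1%N, (fun=> 1), (fun=> x).
by split => //; rewrite big_ord1 ?scale1r.
Qed.

Lemma edist_sqr_le (R : realType) (d : nat) (x y : 'cV[R]_d) (S : set 'cV[R]_d) (a : R) :
  S y -> norm2 (x - y) <= a -> (Defs.edist x S * Defs.edist x S <= (a ^+ 2)%:E)%E.
Proof.
move=> Sy xy.
have e_ge0 : (0 <= Defs.edist x S)%E.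
  by apply: le_ereal_inf_tmp => _ [z _ <-]; rewrite lee_fin norm2_ge0.
have e_le : (Defs.edist x S <= a%:E)%E.
  apply: (@le_trans _ _ (norm2 (x - y))%:E); last by rewrite lee_fin.
  by apply: ereal_inf_lbound; exists y.
by rewrite expr2 EFinM; exact: lee_pmul.
Qed.

Theorem theorem1p2 (R : realType) (Rr delta : R) :
  0 < Rr -> 0 < delta ->
  exists C : R, 0 < C /\
  forall (d : nat) (Xp Xm : set 'cV[R]_d),
    (2 <= d)%N ->
    Xp `<=` ball2 0 Rr -> Xm `<=` ball2 0 Rr ->
    delta_separated delta Xp Xm ->
    Xp `|` Xm !=set0 ->
    let w := gaussian_width (mdiff Xp Xm `|` Xp `|` Xm) in
    let k := C * (32 * Rr / delta ^+ 2) ^+ 2 * (w ^+ 2 + Rr ^+ 2) in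
    forall (N : nat) (gamma : R),
    (finite_set Xp /\ finite_set Xm ->
       N = (#|` fset_set Xp| + #|` fset_set Xm|)%N /\
       gamma = delta ^+ 2 / (18 * Rr * Num.sqrt k)) ->
    (~ (finite_set Xp /\ finite_set Xm) ->
       mutual_complexity delta (144 * delta ^- 2 * Rr ^+ 3 * Num.sqrt k) Xp Xm N /\
       gamma = delta ^+ 2 / (36 * Rr * Num.sqrt k)) ->
    forall (n : nat) (lam eta : R),
    9 * Rr * Num.sqrt k / 8 <= lam ->
    0 < eta < 1 ->
    let q := Rr / (4 * lam * Num.sqrt k) *
             ((2 * delta ^+ 2 / (81 * Rr ^+ 2)) `^ k) in
    ln (N%:R / eta) / q <= n%:R ->
    forall (dO : measure_display) (O : measurableType dO) (P : probability O R)
           (W : 'I_n -> 'I_d -> {RV P >-> R}) (b : 'I_n -> {RV P >-> R}),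
    (forall i j (B : set R), measurable B ->
        P (W i j @^-1` B) = normal_prob 0 1 B) ->
    (forall i (B : set R), measurable B ->
        P (b i @^-1` B) =
          (\int[lebesgue_measure]_(x in B) (uniform_pdf (- lam) lam x)%:E)%E) ->
    mutually_independent
      (fun ij : ('I_n * 'I_d + 'I_n)%type =>
         match ij with inl p => W p.1 p.2 | inr i => b i end) ->
    let Phi := fun (om : O) (x : 'cV[R]_d) =>
      relu ((\matrix_(i < n, j < d) W i j om) *m x + \col_(i < n) b i om) in
    exists F : set O,
      [/\ measurable F,
          F `<=` [set om | lin_sep_margin (Phi om @` Xp) (Phi om @` Xm)
                                          (Mfun Rr gamma N)]
        & ((1 - eta)%:E <= P F)%E].
Proof.
move=> r0 delta0; exists 1000; split; first by rewrite ltr0n.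
move=> d Xp Xm _ Xpr Xmr sep X0 w k N gamma fin_case inf_case n lam eta lam_ge
  /andP[eta0 eta1] q n_ge dO O P W b W_normal b_unif indep Phi.
have k0 : 0 < k.
  apply: mulr_gt0; last by rewrite ltr_wpDl ?sqr_ge0// exprn_gt0.
  by apply: mulr_gt0; [rewrite ltr0n|rewrite exprn_gt0// divr_gt0 ?mulr_gt0 ?exprn_gt0].
have kap0 : 0 < Num.sqrt k by rewrite sqrtr_gt0.
have q0 : 0 < q.
  have lam0 : 0 < lam by apply: lt_le_trans lam_ge; rewrite divr_gt0 ?mulr_gt0.
  apply: mulr_gt0; first by rewrite divr_gt0 ?mulr_gt0.
  by rewrite powR_gt0// divr_gt0 ?mulr_gt0 ?exprn_gt0.
have [[Xp0 Xm0]|Xempty] := pselect (Xp !=set0 /\ Xm !=set0); last first.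
  have XE : Xp = set0 \/ Xm = set0.
    have [->|/set0P Xp0] := eqVneq Xp set0; first by left.
    right; apply/eqP; apply/negPn; apply/negP => /set0P Xm0.
    exact: Xempty.
  have N0 : (0 < N)%N.
    have [fX|nfX] := pselect (finite_set Xp /\ finite_set Xm).
      have [-> _] := fin_case fX; case: fX => fXp fXm.
      rewrite addn_gt0 !cardfs_gt0; apply/orP.
      have [x [Xx|Xx]] := X0; [left|right]; apply/fset0Pn; exists x;
        by rewrite in_fset_set// inE.
    have [[Np [Nm [cp [cm [rp [rm [<- [_ [[cov_p cov_m] _]]]]]]]]] _] := inf_case nfX.
    have [x [/cov_p[i _ _]|/cov_m[i _ _]]] := X0; rewrite addn_gt0.
      by rewrite (leq_ltn_trans _ (ltn_ord i)).
    by rewrite (leq_ltn_trans _ (ltn_ord i)) ?orbT.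
  (* From [eta < 1 <= N] the logarithm is positive, so the lower bound on [n] forces a neuron to
     exist. *)
  have n0 : (0 < n)%N.
    rewrite -(ltr0n R); apply: lt_le_trans n_ge; apply: divr_gt0 => //.
    rewrite ln_gt0// ltr_pdivlMr// mul1r; apply: (lt_le_trans eta1).
    by rewrite ler1n.
  exists setT; split => //.
    move=> om _; apply: one_class_separation => // x i.
    by rewrite mxE le_max lexx orbT.
  by rewrite probability_setT lee_fin gerBl ltW.
have delta_le : delta <= 2 * Rr.
  have [x Xx] := Xp0; have [y Xy] := Xm0; apply: le_trans (sep x y Xx Xy) _.
  apply: le_trans (norm2B_le _ _) _; rewrite mulr2n mulrDl mul1r.
  by apply: lerD; [have := Xpr x Xx|have := Xmr y Xy]; rewrite /ball2 /= subr0.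
have gamma_pos a : 0 < a -> 0 < delta ^+ 2 / (a * Rr * Num.sqrt k).
  by move=> a0; rewrite divr_gt0 ?mulr_gt0 ?exprn_gt0.
have [fX|nfX] := pselect (finite_set Xp /\ finite_set Xm).
  have [NE gammaE] := fin_case fX; case: fX => fXp fXm.
  pose I : finType := (fset_set Xp + fset_set Xm)%type.
  pose eps (l : I) := if l is inl _ then true else false.
  pose ctr (l : I) : 'cV[R]_d := match l with inl x => val x | inr y => val y end.
  have NI : N = #|I| by rewrite NE card_sum !cardfE.
  have ctrX l : (if eps l then Xp else Xm) (ctr l).
    case: l => x /=; have := valP x; by rewrite in_fset_set// inE.
  have ctr_conv l : conv_hull (if eps l then Xp else Xm) (ctr l).
    by apply: sub_conv_hull; exact: ctrX.
  have rad_le (l : I) : 0 <= delta ^+ 2 / (36 * Rr * Num.sqrt k).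
    by rewrite ltW// gamma_pos.
  have ctr_sep l j : eps l != eps j -> delta <= norm2 (ctr l - ctr j).
    have := ctrX l; have := ctrX j.
    case: (eps l); case: (eps j) => //= Xj Xl _; first exact: sep.
    by rewrite -norm2N opprB; exact: sep.
  have self (x : 'cV[R]_d) : ball2 x 0 x.
    rewrite /ball2 /= subrr /norm2 big1 ?sqrtr0// => i _.
    by rewrite mxE expr0n.
  have cov_p x : Xp x -> exists2 l, eps l & ball2 (ctr l) 0 x.
    move=> Xx; have xX : x \in fset_set Xp by rewrite in_fset_set// inE.
    by exists (inl [` xX]%fset); last exact: self.
  have cov_m x : Xm x -> exists2 l, ~~ eps l & ball2 (ctr l) 0 x.
    move=> Xx; have xX : x \in fset_set Xm by rewrite in_fset_set// inE.
    by exists (inr [` xX]%fset); last exact: self.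
  have gamma0 : 0 < gamma by rewrite gammaE; exact: gamma_pos.
  have gamma_le : gamma <= delta ^+ 2 / (18 * Rr * Num.sqrt k) by rewrite gammaE.
  rewrite NI in n_ge *.
  exact: (clusters_separable r0 delta0 delta_le Xpr Xmr Xp0 Xm0 ctr_conv rad_le ctr_sep
    cov_p cov_m gamma0 gamma_le lam_ge eta0 n_ge W_normal b_unif indep).
have [[Np [Nm [cp [cm [rp [rm [NE [_ [[cov_p cov_m] [[conv_p conv_m]
  [[rp_le rm_le] c_sep]]]]]]]]]]] gammaE] := inf_case nfX.
pose I : finType := ('I_Np + 'I_Nm)%type.
pose eps (l : I) := if l is inl _ then true else false.
pose ctr (l : I) : 'cV[R]_d := match l with inl i => cp i | inr j => cm j end.
pose rad (l : I) : R := match l with inl i => rp i | inr j => rm j end.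
have NI : N = #|I| by rewrite -NE card_sum !card_ord.
have ctr_conv l : conv_hull (if eps l then Xp else Xm) (ctr l).
  by case: l => i /=; [apply: conv_hullS (conv_p i)|apply: conv_hullS (conv_m i)] => x [].
have ctr_r l : norm2 (ctr l) <= Rr.
  apply: (conv_hull_norm2 (ctr_conv l)) => x.
  by case: ifP => _ => [/Xpr|/Xmr]; rewrite /ball2 /= subr0.
have ctr_dist l j : norm2 (ctr l - ctr j) <= 2 * Rr.
  by apply: le_trans (norm2B_le _ _) _; rewrite mulr2n mulrDl mul1r; apply: lerD.
have radE (a : R) (E : \bar R) :
    (a%:E <= ((144 * delta ^- 2 * Rr ^+ 3 * Num.sqrt k)^-1)%:E * E)%E ->
    (E <= ((2 * Rr) ^+ 2)%:E)%E -> a <= delta ^+ 2 / (36 * Rr * Num.sqrt k).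
  move=> aE E4; rewrite -lee_fin; apply: (le_trans aE).
  have -> : delta ^+ 2 / (36 * Rr * Num.sqrt k) =
      (144 * delta ^- 2 * Rr ^+ 3 * Num.sqrt k)^-1 * (2 * Rr) ^+ 2.
    by field; rewrite !gt_eqF.
  rewrite EFinM; apply: lee_wpmul2l => //.
  by rewrite lee_fin invr_ge0 !mulr_ge0 ?invr_ge0 ?exprn_ge0// ltW.
have rad_le l : rad l <= delta ^+ 2 / (36 * Rr * Num.sqrt k).
  case: l => i /=.
    apply: radE (rp_le i) _; have [y /cov_m[j _ _]] := Xm0.
    by apply: (@edist_sqr_le _ _ _ (cm j)); [exists j|exact: (ctr_dist (inl i) (inr j))].
  apply: radE (rm_le i) _; have [y /cov_p[j _ _]] := Xp0.
  by apply: (@edist_sqr_le _ _ _ (cp j)); [exists j|exact: (ctr_dist (inr i) (inl j))].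
have ctr_sep l j : eps l != eps j -> delta <= norm2 (ctr l - ctr j).
  case: l j => [i|i] [j|j] //= _; first by apply: c_sep; [exists i|exists j].
  by rewrite -norm2N opprB; apply: c_sep; [exists j|exists i].
have cov_p' x : Xp x -> exists2 l, eps l & ball2 (ctr l) (rad l) x.
  by move=> /cov_p[i _ [_ xi]]; exists (inl i).
have cov_m' x : Xm x -> exists2 l, ~~ eps l & ball2 (ctr l) (rad l) x.
  by move=> /cov_m[i _ [_ xi]]; exists (inr i).
have gamma0 : 0 < gamma by rewrite gammaE; exact: gamma_pos.
have gamma_le : gamma <= delta ^+ 2 / (18 * Rr * Num.sqrt k).
  rewrite gammaE ler_pM2l ?exprn_gt0// lef_pV2 ?posrE ?mulr_gt0//.
  by rewrite ler_pM2r// ler_pM2r// ler_nat.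
rewrite NI in n_ge *.
exact: (clusters_separable r0 delta0 delta_le Xpr Xmr Xp0 Xm0 ctr_conv rad_le ctr_sep
  cov_p' cov_m' gamma0 gamma_le lam_ge eta0 n_ge W_normal b_unif indep).
Qed.
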